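(* There exist constants $c_3, c_4 \geq 1$, independent of $H$, $|\mathcal{X}|$, $|\mathcal{A}|$, $\varepsilon$ and $\delta$, such that the following holds for every finite MDP as in the context, every $\delta\in(0,1)$ and every $\varepsilon \in (0, 1/H]$. If MDVI is run with $$\alpha = 1-(1-\gamma)^2,\qquad K = \left\lceil \frac{5}{1-\alpha}\log\frac{c_3 H}{\varepsilon} + 2\right\rceil,\qquad M = \left\lceil \frac{c_4 H}{\varepsilon^2}\log\frac{16 K |\mathcal{X}||\mathcal{A}|}{\delta}\right\rceil,$$ then with probability at least $1-\delta$ its last output policy satisfies $\|v^* - v^{\pi_K}\|_\infty \leq \varepsilon$. The total number of generative-model samples used, $KM|\mathcal{X}||\mathcal{A}|$, is $\widetilde{O}(H^3|\mathcal{X}||\mathcal{A}|/\varepsilon^2)$, where $\widetilde{O}$ hides factors poly-logarithmic in $H,|\mathcal{X}|,|\mathcal{A}|,1/\varepsilon,1/\delta$.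
   Context: MDP: finite state set $\mathcal{X}$, finite action set $\mathcal{A}$, discount $\gamma\in[0,1)$, reward $r \in [-1,1]^{\mathcal{X}\times\mathcal{A}}$, transition kernel $P(y|x,a)$; $H = 1/(1-\gamma)$. For $v\in\mathbb{R}^{\mathcal{X}}$, $(Pv)(x,a)=\sum_y P(y|x,a)v(y)$. A policy $\pi$ acts on $q\in\mathbb{R}^{\mathcal{X}\times\mathcal{A}}$ by $(\pi q)(x)=\sum_a \pi(a|x)q(x,a)$; $T^\pi q = r + \gamma P\pi q$; $q^\pi$ is the unique fixed point of $T^\pi$ and $v^\pi = \pi q^\pi$; $v^*$ is the optimal value function. A generative model returns, on query $(x,a)$, an independent sample $y\sim P(\cdot|x,a)$. MDVI$(\alpha,K,M)$ with $\alpha\in[0,1)$: set $s_0 = 0$, $w_0=w_{-1}=0$. For $k=0,\dots,K-1$: let $v_k = w_k - \alpha w_{k-1}$; for each $(x,a)$ draw $M$ independent samples $y_{k,m,x,a}\sim P(\cdot|x,a)$ and set $q_{k+1}(x,a) = r(x,a) + \frac{\gamma}{M}\sum_{m=1}^M v_k(y_{k,m,x,a})$; set $s_{k+1} = q_{k+1} + \alpha s_k$ and $w_{k+1}(x) = \max_a s_{k+1}(x,a)$. Output $(\pi_k)_{k=0}^K$ where $\pi_k$ is a deterministic greedy policy with respect to $s_k$. *)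

(* Defs.v *)
From HB Require Import structures.
From mathcomp Require Import all_boot all_order all_algebra.
From mathcomp Require Import boolp classical_sets reals exp.
Set Implicit Arguments. Unset Strict Implicit. Unset Printing Implicit Defensive.
Import Order.TTheory GRing.Theory Num.Theory.
Local Open Scope ring_scope.
Local Open Scope classical_set_scope.

Section MDP.
Variables (R : realType) (X A : finType).

Definition is_mdp (gamma : R) (r : X -> A -> R) (P : X -> A -> X -> R) :=
  [/\ 0 <= gamma < 1,
      (forall x a, -1 <= r x a <= 1),
      (forall x a y, 0 <= P x a y) &
      (forall x a, \sum_y P x a y = 1)].

Definition is_policy (pi : X -> A -> R) :=
  (forall x a, 0 <= pi x a) /\ (forall x, \sum_a pi x a = 1).

Definition Tpi (gamma : R) (r : X -> A -> R) (P : X -> A -> X -> R)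
  (pi : X -> A -> R) (q : X -> A -> R) : X -> A -> R :=
  fun x a => r x a + gamma * \sum_y P x a y * (\sum_b pi y b * q y b).

(** q^pi: the (unique) fixed point of T^pi (chosen by classical choice). *)
Definition qpi gamma r P pi : X -> A -> R :=
  xget (fun _ _ => 0) [set q | Tpi gamma r P pi q = q].

Definition vpi gamma r P pi : X -> R :=
  fun x => \sum_a pi x a * qpi gamma r P pi x a.

Definition vstar gamma r P : X -> R :=
  fun x => sup [set vpi gamma r P pi x | pi in is_policy].

Definition supnorm (v : X -> R) : R := \big[Num.max/0]_x `|v x|.

Definition maxA (a0 : A) (f : A -> R) : R := \big[Num.max/f a0]_a f a.

Definition detpol (d : X -> A) : X -> A -> R := fun x a => (a == d x)%:R.

(** one MDVI iteration, given samples samp m x a (m < M) for iteration k.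
    State is (s_k, w_k, w_{k-1}). *)
Definition mdvi_step (a0 : A) (alpha gamma : R) (r : X -> A -> R) (M : nat)
  (samp : nat -> X -> A -> X)
  (st : (X -> A -> R) * (X -> R) * (X -> R)) :=
  let: (s, w, wp) := st in
  let v := fun y => w y - alpha * wp y in
  let q := fun x a => r x a + gamma / M%:R * \sum_(m < M) v (samp m x a) in
  let s' := fun x a => q x a + alpha * s x a in
  let w' := fun x => maxA a0 (s' x) in
  (s', w', w).

Fixpoint mdvi (a0 : A) (alpha gamma : R) (r : X -> A -> R) (M : nat)
  (samp : nat -> nat -> X -> A -> X) (n : nat)
  : (X -> A -> R) * (X -> R) * (X -> R) :=
  match n with
  | 0 => (fun _ _ => 0, fun _ => 0, fun _ => 0)
  | k.+1 => mdvi_step a0 alpha gamma r M (samp k)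
              (mdvi a0 alpha gamma r M samp k)
  end.

(** Sample space for K iterations with M samples per (x,a):
    omega (k, m, x, a) = y_{k,m,x,a}. *)
Definition Omega (K M : nat) := {ffun 'I_K * 'I_M * X * A -> X}.

Definition samp_of (K M : nat) (om : Omega K M) : nat -> nat -> X -> A -> X :=
  fun k m x a =>
    match insub k, insub m with
    | Some k', Some m' => om (k', m', x, a)
    | _, _ => x
    end.

(** Law of the samples: all independent, y_{k,m,x,a} ~ P(.|x,a). *)
Definition weight (P : X -> A -> X -> R) (K M : nat) (om : Omega K M) : R :=
  \prod_(i : 'I_K * 'I_M * X * A) P i.1.2 i.2 (om i).

Definition Pr (P : X -> A -> X -> R) (K M : nat) (E : pred (Omega K M)) : R :=
  \sum_(om | E om) weight P om.

Definition greedy_selector (sel : (X -> A -> R) -> X -> A) :=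
  forall (q : X -> A -> R) x a, q x a <= q x (sel q x).

End MDP.

(* Main.v *)
Require Import Defs.
From HB Require Import structures.
From mathcomp Require Import all_boot all_order all_algebra.
From mathcomp Require Import boolp classical_sets reals sequences exp.
From mathcomp Require Import ring lra.
Import Order.TTheory GRing.Theory Num.Theory.
Local Open Scope ring_scope.

Set Implicit Arguments.
Unset Strict Implicit.
Unset Printing Implicit Defensive.

(* Let [H = 1 / (1 - gamma)].  Writing [E_k] for the geometrically weighted sum of the
   sampling errors, the scores telescope to
     s_k = H^2 (1 - alpha^k) r + gamma P w_(k-1) + E_k,
   so [w_k / H^2] is an approximate Bellman fixed point whose defect is governed by [E_k]
   and by the increment [w_k - w_(k-1)], itself driven by [E_k - E_(k-1)].  All error
   propagation is done with potentials: if [G >= gamma P_a G + b] for every action [a],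
   then [G] bounds the discounted sum of [b] along any sequence of policies.  For the
   one-step variance of the optimal value [V] such a potential is
     4 H^2 + 2 H V - V^2  <=  5 H^2,
   which replaces the law of total variance and saves a factor [H] over the naive
   bound [H * H^2].  The errors are controlled by exponential supermartingales
     exp (lambda N - 2 lambda^2 W / M),   W the predictable variance,
   at three fixed values of [lambda].  A first, crude pass shows that the values used by
   the algorithm are within [sqrt H] (up to a decaying term) of [V] because [eps <= 1/H];
   hence [W] is comparable to the variance of [V], and a second pass gives [eps]. *)

(** * Contractions and expectations *)

Section Contraction.
Variables (R : realType) (X : finType) (gamma : R).
Hypothesis gamma01 : 0 <= gamma < 1.

(* If [h] had a positive maximum [m], then [m <= gamma * m < m]. *)
Lemma contraction_le0 (h : X -> R) :
  (forall x m, 0 <= m -> (forall y, h y <= m) -> h x <= gamma * m) ->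
  forall x, h x <= 0.
Proof.
move=> hle x; rewrite leNgt; apply/negP => hx0.
have [y _ hy] := @arg_maxP _ R X x xpredT h isT.
have hmax z : h z <= h y by exact: hy.
have hxy := hmax x.
have := hle y (h y) ltac:(lra) hmax.
by move: gamma01 => /andP[g0 g1] ?; nra.
Qed.

Section Operator.
Variable T : (X -> R) -> X -> R.
Hypothesis T_mono : forall f g, (forall x, f x <= g x) -> forall x, T f x <= T g x.
Hypothesis T_shift : forall f c, 0 <= c -> forall x, T (fun y => f y + c) x <= T f x + gamma * c.

(** Comparison principle: if [f - g <= m] with [m >= 0], then monotonicity and the shift bound give
    [f - g <= gamma * m], so [contraction_le0] applies. *)
Lemma sub_le_super (f g : X -> R) :
  (forall x, f x <= T f x) -> (forall x, T g x <= g x) -> forall x, f x <= g x.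
Proof.
move=> fT Tg x; rewrite -subr_le0; move: x.
apply: (@contraction_le0 (fun x => f x - g x)) => x m m0 hm.
have : T f x <= T (fun y => g y + m) x.
  by apply: T_mono => y; have := hm y; lra.
by have := T_shift g m0 x; have := fT x; have := Tg x; lra.
Qed.

(* Tarski: the pointwise infimum of the supersolutions is a fixed point. *)
Lemma contraction_fixpoint : exists f, T f = f.
Proof.
move: (gamma01) => /andP[g0 g1].
(* With this radius the constant [c] is a supersolution and [- c] a subsolution, so each set [S x]
   is nonempty and bounded below. *)
pose c : R := (1 - gamma)^-1 * \big[Num.max/0]_x `|T (fun=> 0) x|.
have i0 : 0 < (1 - gamma)^-1 by rewrite invr_gt0 subr_gt0.
have cE x : `|T (fun=> 0) x| <= (1 - gamma) * c.
  by rewrite mulrA divff ?mul1r ?(le_bigmax 0 (fun x => `|T (fun=> 0) x|)) //; lra.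
have c0 : 0 <= c by apply: mulr_ge0; [exact: ltW | exact: bigmax_ge_id].
pose S x := [set f x | f in [set f | forall x, T f x <= f x]]%classic.
have supc x : T (fun=> c) x <= c.
  have := T_shift (fun=> 0) c0 x; have := cE x.
  have -> : (fun=> 0 + c) = (fun=> c) :> (X -> R) by apply/funext => y; rewrite add0r.
  by rewrite ler_norml => /andP[? ?]; lra.
have subc x : - c <= T (fun=> - c) x.
  have := T_shift (fun=> - c) c0 x; have := cE x.
  have -> : (fun=> - c + c) = (fun=> 0) :> (X -> R) by apply/funext => y; rewrite addNr.
  by rewrite ler_norml => /andP[? ?]; lra.
have S0 x : (S x !=set0)%classic by exists c, (fun=> c).
have Slb x : lbound (S x) (- c).
  by move=> _ [f fP <-]; exact: (@sub_le_super (fun=> - c)).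
pose f x := inf (S x).
have fle g : (forall x, T g x <= g x) -> forall x, f x <= g x.
  by move=> gP x; apply: ge_inf; [exists (- c); exact: Slb | exists g].
have Tf x : T f x <= f x.
  apply: lb_le_inf => // _ [g gP <-]; apply: le_trans (gP x).
  by apply: T_mono; exact: fle.
(* By monotonicity [T f] is again a supersolution, so the infimum [f] lies below it. *)
exists f; apply/funext => x; apply: le_anti; rewrite Tf /=.
by apply: fle => y; apply: T_mono.
Qed.

End Operator.
End Contraction.

Section Expectation.
Variables (R : realType) (X : finType).
Implicit Types (p f g : X -> R).

Definition is_dist p := (forall y, 0 <= p y) /\ \sum_y p y = 1.

Definition expect p f : R := \sum_y p y * f y.

Definition variance p f : R := expect p (fun y => (f y - expect p f) ^+ 2).

Lemma expectD p f g : expect p (fun y => f y + g y) = expect p f + expect p g.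
Proof. by rewrite -big_split; apply: eq_bigr => y _; rewrite mulrDr. Qed.

Lemma expectZ p c f : expect p (fun y => c * f y) = c * expect p f.
Proof. by rewrite big_distrr; apply: eq_bigr => y _; rewrite mulrCA. Qed.

Lemma expectN p f : expect p (fun y => - f y) = - expect p f.
Proof. by rewrite /expect -sumrN; apply: eq_bigr => y _; rewrite mulrN. Qed.

Section Distribution.
Variable p : X -> R.
Hypothesis p_dist : is_dist p.

Lemma expect_cst c : expect p (fun=> c) = c.
Proof. by rewrite /expect -big_distrl /= (proj2 p_dist) mul1r. Qed.

Lemma expect_le f g : (forall y, f y <= g y) -> expect p f <= expect p g.
Proof.
by move=> fg; apply: ler_sum => y _; apply: ler_wpM2l => //; exact: (proj1 p_dist).
Qed.

Lemma expect_norm_le f c : (forall y, `|f y| <= c) -> `|expect p f| <= c.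
Proof.
move=> fc; rewrite ler_norml -{1}(expect_cst (- c)) -{2}(expect_cst c).
by apply/andP; split; apply: expect_le => y; have := fc y; rewrite ler_norml => /andP[].
Qed.

Lemma variance_ge0 f : 0 <= variance p f.
Proof. by rewrite -(expect_cst 0); apply: expect_le => y; exact: sqr_ge0. Qed.

Lemma varianceE f : variance p f = expect p (fun y => f y ^+ 2) - expect p f ^+ 2.
Proof.
rewrite /variance; set m := expect p f.
have -> : (fun y => (f y - m) ^+ 2) = (fun y => f y ^+ 2 + ((- 2 * m) * f y + m ^+ 2)).
  by apply/funext => y; ring.
by rewrite !expectD expectZ expect_cst -/m; ring.
Qed.

Lemma variance_le_sqr f c : (forall y, `|f y| <= c) -> variance p f <= c ^+ 2.
Proof.
move=> fc; rewrite varianceE; apply: (@le_trans _ _ (expect p (fun y => f y ^+ 2))).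
  by rewrite gerBl sqr_ge0.
rewrite -[leRHS]expect_cst; apply: expect_le => y.
by have := fc y; rewrite ler_norml => /andP[? ?]; nra.
Qed.

(** Split the centered [f] into the centered [g] and the centered [f - g], and use
    [(a + b)^2 <= 2 a^2 + 2 b^2]. This trades the variance of the iterates for that of the optimal
    value. *)
Lemma variance_perturb f g c :
  (forall y, `|f y - g y| <= c) -> variance p f <= 2 * variance p g + 2 * c ^+ 2.
Proof.
move=> fgc.
apply: (@le_trans _ _ (2 * variance p g + 2 * variance p (fun y => f y - g y))).
  rewrite /variance -!expectZ -expectD; apply: expect_le => y.
  rewrite expectD expectN.
  set a := expect p f; set b := expect p g.
  suff : 0 <= ((g y - b) - (f y - g y - (a - b))) ^+ 2 by lra.
  exact: sqr_ge0.
by have := variance_le_sqr fgc; lra.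
Qed.

End Distribution.
End Expectation.

(** * Bellman operators *)

Local Notation maxA := Defs.maxA.

Section MaxA.
Variables (R : realType) (A : finType) (a0 : A).
Implicit Types f g : A -> R.

Lemma maxA_ge f a : f a <= maxA a0 f.
Proof. exact: le_bigmax. Qed.

Lemma maxA_le f c : (forall a, f a <= c) -> maxA a0 f <= c.
Proof. by move=> fc; apply: bigmax_le. Qed.

Lemma maxA_attained f : exists a, maxA a0 f = f a.
Proof.
rewrite /maxA; elim/big_ind: _ => [|u v [a ->] [b ->]|a _]; [by exists a0| |by exists a].
by rewrite /Num.max; case: ifP => _; [exists b | exists a].
Qed.

Lemma maxA_greedy f a : (forall b, f b <= f a) -> maxA a0 f = f a.
Proof. by move=> fa; apply: le_anti; rewrite maxA_ge maxA_le. Qed.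

Lemma maxA_dist f g c :
  (forall a, `|f a - g a| <= c) -> `|maxA a0 f - maxA a0 g| <= c.
Proof.
move=> fgc.
have fc : maxA a0 f <= maxA a0 g + c.
  apply: maxA_le => a; have := fgc a; have := maxA_ge g a.
  by rewrite ler_norml => ? /andP[? ?]; lra.
have gc : maxA a0 g <= maxA a0 f + c.
  apply: maxA_le => a; have := fgc a; have := maxA_ge f a.
  by rewrite ler_norml => ? /andP[? ?]; lra.
by rewrite ler_norml; apply/andP; split; lra.
Qed.

End MaxA.

Section MDPValues.
Variables (R : realType) (X A : finType) (a0 : A) (gamma : R).
Variables (r : X -> A -> R) (P : X -> A -> X -> R).
Hypothesis mdp : is_mdp gamma r P.

Lemma mdp_gamma : 0 <= gamma < 1. Proof. by case: mdp. Qed.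

Lemma mdp_gamma_ge0 : 0 <= gamma. Proof. by case/andP: mdp_gamma. Qed.

Lemma mdp_reward x a : -1 <= r x a <= 1. Proof. by case: mdp. Qed.

Lemma mdp_dist x a : is_dist (P x a).
Proof. by case: mdp => _ _ P0 P1; split; [exact: P0 | exact: P1]. Qed.

Definition backup (f : X -> R) x a := r x a + gamma * expect (P x a) f.

Lemma backup_le f g x a : (forall y, f y <= g y) -> backup f x a <= backup g x a.
Proof.
move=> fg; rewrite lerD2l ler_wpM2l ?mdp_gamma_ge0 //.
by apply: expect_le fg; exact: mdp_dist.
Qed.

Lemma backup_shift f c x a : backup (fun y => f y + c) x a = backup f x a + gamma * c.
Proof. by rewrite /backup expectD (expect_cst (mdp_dist x a)) mulrDr addrA. Qed.

(** The optimality equation split into its two inequalities, which serve separately: the first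
    bounds every policy value and hence [vstar] from above, the second bounds [V] itself. *)
Definition bellman_optimal (V : X -> R) :=
  (forall x a, backup V x a <= V x) /\ (forall x, exists a, V x = backup V x a).

Lemma bellman_optimal_exists : exists V, bellman_optimal V.
Proof.
have [|f c c0 x|V VE] := @contraction_fixpoint R X gamma mdp_gamma
  (fun f x => maxA a0 (backup f x)).
- move=> f g fg x; apply: maxA_le => a.
  by apply: le_trans (maxA_ge a0 (backup g x) a); exact: backup_le.
- by apply: maxA_le => a; rewrite backup_shift lerD2r maxA_ge.
have {}VE x : V x = maxA a0 (backup V x) by rewrite -{1}VE.
exists V; split=> [x a|x]; first by rewrite [leRHS]VE maxA_ge.
by rewrite VE; exact: maxA_attained.
Qed.

Section Policy.
Variable pi : X -> A -> R.
Hypothesis pi_policy : is_policy pi.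

Let policyT f x := \sum_a pi x a * backup f x a.

Let policyT_mono f g : (forall x, f x <= g x) -> forall x, policyT f x <= policyT g x.
Proof.
move=> fg x; apply: ler_sum => a _; apply: ler_wpM2l; last exact: backup_le.
exact: (proj1 pi_policy).
Qed.

Let policyT_shift f c : 0 <= c -> forall x,
  policyT (fun y => f y + c) x <= policyT f x + gamma * c.
Proof.
move=> _ x; rewrite /policyT; under eq_bigr => a _ do rewrite backup_shift mulrDr.
by rewrite big_split /= -[X in _ + X]big_distrl /= (proj2 pi_policy) mul1r.
Qed.

(** [qpi] is picked by choice, so only existence is at stake: a fixed point [v] on states yields the
    fixed point [backup v] on state-action pairs. *)
Lemma qpi_fixpoint : Tpi gamma r P pi (qpi gamma r P pi) = qpi gamma r P pi.
Proof.
rewrite /qpi; case: xgetP => [q _ //|noq].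
have [v vE] := contraction_fixpoint mdp_gamma policyT_mono policyT_shift.
case: (noq (backup v)); apply/funext => x; apply/funext => a.
rewrite /Tpi /backup /expect; congr (_ + _ * _); apply: eq_bigr => y _.
by congr (_ * _); rewrite -{2}vE.
Qed.

Lemma vpiE x : vpi gamma r P pi x = \sum_a pi x a * backup (vpi gamma r P pi) x a.
Proof.
rewrite {1}/vpi; apply: eq_bigr => a _; congr (_ * _).
by rewrite -{1}qpi_fixpoint.
Qed.

Lemma vpi_le_super g : (forall x a, backup g x a <= g x) ->
  forall x, vpi gamma r P pi x <= g x.
Proof.
move=> gS; apply: (sub_le_super mdp_gamma policyT_mono policyT_shift) => x.
  by rewrite {1}vpiE.
rewrite -[leRHS]mul1r -(proj2 pi_policy x) big_distrl /=; apply: ler_sum => a _.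
by apply: ler_wpM2l (gS x a); exact: (proj1 pi_policy).
Qed.

Lemma vpi_ge_sub f : (forall x, f x <= \sum_a pi x a * backup f x a) ->
  forall x, f x <= vpi gamma r P pi x.
Proof.
move=> fS; apply: (sub_le_super mdp_gamma policyT_mono policyT_shift) => // x.
by rewrite [leRHS]vpiE.
Qed.

End Policy.

Lemma detpol_policy (d : X -> A) : is_policy (@detpol R X A d).
Proof.
split=> [x a|x]; first by rewrite ler0n.
by rewrite (bigD1 (d x)) //= /detpol eqxx big1 ?addr0 // => a /negbTE ->.
Qed.

Lemma sum_detpol (d : X -> A) x (f : A -> R) : \sum_a detpol R d x a * f a = f (d x).
Proof.
rewrite (bigD1 (d x)) //= /detpol eqxx mul1r big1 ?addr0 // => a /negbTE ->.
by rewrite mul0r.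
Qed.

Lemma vstar_le_super g : (forall x a, backup g x a <= g x) ->
  forall x, vstar gamma r P x <= g x.
Proof.
move=> gS x; apply: ge_sup; last by move=> _ [pi piP <-]; exact: vpi_le_super.
exists (vpi gamma r P (@detpol R X A (fun=> a0)) x).
by exists (@detpol R X A (fun=> a0)) => //; exact: detpol_policy.
Qed.

Lemma vpi_le_vstar pi : is_policy pi ->
  forall x, vpi gamma r P pi x <= vstar gamma r P x.
Proof.
(* [V] provides the upper bound that makes the supremum defining [vstar] meaningful. *)
move=> piP x; have [V [VS _]] := bellman_optimal_exists.
apply: ub_le_sup; last by exists pi.
by exists (V x) => _ [pi' piP' <-]; exact: vpi_le_super.
Qed.

(* [G] is a potential dominating the discounted accumulation of [eps] along every
   trajectory, so it bounds both comparison errors at once. *)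
Lemma approx_greedy_error (V u G : X -> R) (eps : X -> A -> R) (d : X -> A) :
  bellman_optimal V ->
  (forall x a, backup u x a - eps x a <= u x) ->
  (forall x, u x <= backup u x (d x) + eps x (d x)) ->
  (forall x a, gamma * expect (P x a) G + eps x a <= G x) ->
  forall x, `|u x - V x| <= G x /\ V x - vpi gamma r P (@detpol R X A d) x <= 2 * G x.
Proof.
move=> [VS VE] uS uE GS.
have backupN f g x a : backup (fun y => f y - g y) x a = backup f x a - gamma * expect (P x a) g.
  by rewrite /backup expectD expectN; ring.
have backupD f g x a : backup (fun y => f y + g y) x a = backup f x a + gamma * expect (P x a) g.
  by rewrite /backup expectD; ring.
(* The potential makes [u - G] a subsolution for the policy [d] and [u + G] an upper bound of [V];
   since the value of [d] is at most [V], both conclusions follow. *)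
have uGsub x : u x - G x <= backup (fun y => u y - G y) x (d x).
  by rewrite backupN; have := uE x; have := GS x (d x); lra.
have uGV x : u x - G x <= vpi gamma r P (@detpol R X A d) x.
  apply: (vpi_ge_sub (detpol_policy d) (f := fun y => u y - G y)) => {}x.
  by rewrite sum_detpol.
have vV x : vpi gamma r P (@detpol R X A d) x <= V x.
  exact: (vpi_le_super (detpol_policy d)).
have VuG x : V x <= u x + G x.
  rewrite -subr_le0; move: x.
  apply: (contraction_le0 mdp_gamma (h := fun x => V x - (u x + G x))) => x m m0 hm.
  have [a VEx] := VE x.
  have : backup V x a <= backup (fun y => (u y + G y) + m) x a.
    by apply: backup_le => y; have := hm y; lra.
  by rewrite backup_shift backupD -VEx; have := uS x a; have := GS x a; lra.
move=> x; have := uGV x; have := vV x; have := VuG x.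
by move=> ? ? ?; split; [rewrite ler_norml; apply/andP; split|]; lra.
Qed.

Local Notation H := ((1 - gamma)^-1).

Lemma horizon_gt0 : 0 < H.
Proof. by rewrite invr_gt0 subr_gt0; case/andP: mdp_gamma. Qed.

Lemma horizonE : (1 - gamma) * H = 1.
Proof. by rewrite divff // subr_eq0 eq_sym; case/andP: mdp_gamma => _ /lt_eqF ->. Qed.

Lemma horizon_ge1 : 1 <= H.
Proof. by have := horizonE; have := horizon_gt0; have := mdp_gamma_ge0; nra. Qed.

Section Potential.
Variable V : X -> R.
Hypothesis V_opt : bellman_optimal V.

(** Rewards lie in [-1, 1] and [1 + gamma * H = H]. The lower bound passes through the value of the
    constant policy [a0], which [V] dominates. *)
Lemma bellman_optimal_norm x : `|V x| <= H.
Proof.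
have [VS VE] := V_opt; have HE := horizonE; have H0 := horizon_gt0.
have bc c y a : backup (fun=> c) y a = r y a + gamma * c.
  by rewrite /backup (expect_cst (mdp_dist y a)).
rewrite ler_norml; apply/andP; split.
  apply: le_trans (vpi_le_super (detpol_policy (fun=> a0)) VS x).
  apply: (vpi_ge_sub (detpol_policy _) (f := fun=> - H)) => y.
  by rewrite sum_detpol bc; have := mdp_reward y a0; move/andP => [? ?]; lra.
rewrite -subr_le0; move: x.
apply: (contraction_le0 mdp_gamma (h := fun x => V x - H)) => y m m0 hm.
have [a VEy] := VE y.
have : backup V y a <= backup (fun=> H + m) y a.
  by apply: backup_le => z; have := hm z; lra.
by rewrite bc -VEy; have := mdp_reward y a; move/andP => [? ?]; lra.
Qed.

(** Equal to [5 H^2 - (H - V)^2], hence between [H^2] and [5 H^2] when [|V| <= H]. The term [- V^2]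
    produces the variance, [4 H^2] a slack of [4 H] per discounted step. *)
Definition var_potential x : R := 4 * H ^+ 2 + 2 * H * V x - V x ^+ 2.

Definition opt_var x a : R := gamma ^+ 2 * variance (P x a) V.

Lemma var_potential_ge0 x : 0 <= var_potential x.
Proof.
have := bellman_optimal_norm x; have := horizon_gt0.
by rewrite /var_potential ler_norml => ? /andP[? ?]; nra.
Qed.

Lemma var_potential_le x : var_potential x <= 5 * H ^+ 2.
Proof. by have := sqr_ge0 (H - V x); rewrite /var_potential; lra. Qed.

Lemma opt_var_ge0 x a : 0 <= opt_var x a.
Proof. by rewrite mulr_ge0 ?sqr_ge0 // variance_ge0 //; exact: mdp_dist. Qed.

(* Total variance in potential form: since [gamma * P V = q - r] with [q <= V], the
   one-step variance telescopes along every policy, optimal or not. *)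
Lemma var_potential_super x a :
  gamma * expect (P x a) var_potential + opt_var x a <= var_potential x.
Proof.
have [VS _] := V_opt; have pd := mdp_dist x a.
have -> : expect (P x a) var_potential =
    4 * H ^+ 2 + 2 * H * expect (P x a) V - expect (P x a) (fun y => V y ^+ 2).
  by rewrite /var_potential !expectD (expect_cst pd) expectZ expectN.
rewrite /opt_var (varianceE pd) /var_potential.
have := VS x a; rewrite /backup.
have E2 : 0 <= expect (P x a) (fun y => V y ^+ 2).
  by rewrite -(expect_cst pd 0); apply: (expect_le pd) => y; exact: sqr_ge0.
move: (expect _ (fun y => V y ^+ 2)) E2 => e2 E2.
have := expect_norm_le pd bellman_optimal_norm.
move: (expect _ V) => e1.
have := bellman_optimal_norm x; have := mdp_reward x a.
have := horizonE; have := horizon_ge1; have := mdp_gamma.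
move: H (V x) (r x a) => h v rr /andP[g0 g1] h1 hE /andP[r0 r1].
rewrite !ler_norml => /andP[v0 v1] /andP[e10 e11] bk.
set q := gamma * e1 in bk *.
have e2g : gamma ^+ 2 * e2 <= gamma * e2.
  by rewrite expr2 -mulrA ler_wpM2l // ler_piMl // ltW.
have h4 : (1 - gamma) * (4 * h ^+ 2) = 4 * h by rewrite expr2 mulrCA (mulrA (1 - gamma)) hE mul1r.
have qn : - h <= q <= h.
  rewrite -ler_norml normrM ger0_norm // -[leRHS]mul1r ler_pM //; first exact: ltW.
  by rewrite ler_norml e10.
(* Both factors are nonnegative because [v >= r + q >= q - 1] and [v, q <= h]. Expanded, this bounds
   [2 h (v - q) - (v^2 - q^2)] below by [- (2 h - v - q) >= - 4 h], which the slack [h4] pays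
   for. *)
have : 0 <= (v - q + 1) * (2 * h - v - q) by apply: mulr_ge0; move/andP: qn => [? ?]; lra.
have -> : gamma * (4 * h ^+ 2 + 2 * h * e1 - e2) = gamma * (4 * h ^+ 2) + 2 * h * q - gamma * e2.
  by rewrite /q; ring.
have -> : gamma ^+ 2 * (e2 - e1 ^+ 2) = gamma ^+ 2 * e2 - q ^+ 2 by rewrite /q; ring.
by move/andP: qn => [? ?] ?; lra.
Qed.

End Potential.
End MDPValues.

(** * The MDVI recursion *)

Section Run.
Variables (R : realType) (X A : finType) (a0 : A) (gamma : R).
Variables (r : X -> A -> R) (P : X -> A -> X -> R).
Hypothesis mdp : is_mdp gamma r P.
Variables (M : nat) (samp : nat -> nat -> X -> A -> X).
Hypothesis M_gt0 : (0 < M)%N.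

Local Notation H := ((1 - gamma)^-1).
Local Notation alpha := (1 - (1 - gamma) ^+ 2).
(** A rate strictly between [alpha] and 1: transients decaying like [beta^k] stay of that form when
    summed against powers of [alpha], as [1 / (beta - alpha) = 2 H^2], or of [gamma], as
    [1 / (beta - gamma) <= 2 H]. *)
Local Notation beta := (1 - (1 - gamma) ^+ 2 / 2).

Definition score n : X -> A -> R := (mdvi a0 alpha gamma r M samp n).1.1.
Definition wval n : X -> R := (mdvi a0 alpha gamma r M samp n).1.2.
Definition wprev n : X -> R := (mdvi a0 alpha gamma r M samp n).2.
Definition vval n : X -> R := fun y => wval n y - alpha * wprev n y.

Definition noise n x a : R :=
  gamma / M%:R * \sum_(m < M) vval n (samp n m x a) - gamma * expect (P x a) (vval n).

(** The conditional variance of [noise] is this quantity divided by [M]. Accordingly [acc_var]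
    carries squared weights: it is [M] times the predictable quadratic variation of [acc_noise]. *)
Definition noise_var n x a : R := gamma ^+ 2 * variance (P x a) (vval n).

Fixpoint acc_noise n x a : R :=
  if n is k.+1 then noise k x a + alpha * acc_noise k x a else 0.

Fixpoint acc_var n x a : R :=
  if n is k.+1 then noise_var k x a + alpha ^+ 2 * acc_var k x a else 0.

Lemma wprevS n : wprev n.+1 = wval n.
Proof. by rewrite /wprev /wval /=; case: (mdvi _ _ _ _ _ _ n) => [[s w] wp]. Qed.

Lemma scoreS n x a : score n.+1 x a =
  r x a + gamma / M%:R * \sum_(m < M) vval n (samp n m x a) + alpha * score n x a.
Proof.
rewrite /score /vval /wval /wprev /=.
by case: (mdvi _ _ _ _ _ _ n) => [[s w] wp].
Qed.

Lemma wvalE n x : wval n x = maxA a0 (score n x).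
Proof.
case: n => [|n]; last first.
  by rewrite /wval /score /=; case: (mdvi _ _ _ _ _ _ n) => [[s w] wp].
by have [a ->] := maxA_attained a0 (score 0 x).
Qed.

Let gam := mdp_gamma mdp.
Let HE := horizonE mdp.
Let H1 := horizon_ge1 mdp.
Let H0 := horizon_gt0 mdp.

Lemma sqr_horizonE : (1 - gamma) ^+ 2 * H ^+ 2 = 1.
Proof. by rewrite -exprMn HE expr1n. Qed.

Lemma alpha_ge0 : 0 <= alpha.
Proof. by move/andP: gam => [? ?]; nra. Qed.

Lemma alpha_le_beta : alpha <= beta.
Proof. by have := sqr_ge0 (1 - gamma); lra. Qed.

Lemma beta_ge0 : 0 <= beta.
Proof. exact: le_trans alpha_ge0 alpha_le_beta. Qed.

Lemma betaX_ge0 k : 0 <= beta ^+ k.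
Proof. by rewrite exprn_ge0 // beta_ge0. Qed.

Lemma alphaX_le_betaX k : alpha ^+ k <= beta ^+ k.
Proof. by apply: lerXn2r; rewrite ?nnegrE ?alpha_ge0 ?beta_ge0 ?alpha_le_beta. Qed.

Lemma betaX_le1 k : beta ^+ k <= 1.
Proof. by rewrite exprn_ile1 // ?beta_ge0 //; have := sqr_ge0 (1 - gamma); lra. Qed.

(** As [v_k = w_k - alpha * w_(k-1)], the weighted sum of the [P v_k] telescopes to [P w_(n-1)]; the
    rewards form a geometric sum of ratio [alpha], with [1 - alpha = H^-2]. *)
Lemma score_decomp n x a :
  score n x a = H ^+ 2 * (1 - alpha ^+ n) * r x a
    + gamma * expect (P x a) (wprev n) + acc_noise n x a.
Proof.
elim: n => [|n IH].
  rewrite expr0 subrr mulr0 mul0r add0r /= addr0.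
  by rewrite /wprev /score /= (expect_cst (mdp_dist mdp x a)) mulr0.
rewrite scoreS IH wprevS /= /noise.
have -> : expect (P x a) (vval n) = expect (P x a) (wval n) - alpha * expect (P x a) (wprev n).
  by rewrite /vval expectD expectN expectZ.
apply/eqP; rewrite -subr_eq0; apply/eqP.
transitivity ((1 - (1 - gamma) ^+ 2 * H ^+ 2) * r x a); last by rewrite sqr_horizonE; ring.
by rewrite (exprS alpha n); ring.
Qed.

(** For every outcome of the samples, [v_(n+1)] is a difference of maxima of [s_(n+1)] and
    [alpha * s_n], hence at most the largest [|q_(n+1)| <= 1 + gamma * H = H]. *)
Lemma vval_norm n y : `|vval n y| <= H.
Proof.
elim: n y => [|n IH] y.
  by rewrite /vval /wval /wprev /= mulr0 subr0 normr0 ltW.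
rewrite /vval wprevS !wvalE.
have -> : alpha * maxA a0 (score n y) = maxA a0 (fun a => alpha * score n y a).
  have [a mE] := maxA_attained a0 (score n y).
  rewrite mE (@maxA_greedy _ _ a0 _ a) // => b.
  by rewrite ler_wpM2l ?alpha_ge0 // -mE maxA_ge.
apply: maxA_dist => a; rewrite scoreS addrK.
have r1 := mdp_reward mdp y a.
have : `|gamma / M%:R * \sum_(m < M) vval n (samp n m y a)| <= gamma * H.
  rewrite normrM normrM (ger0_norm (mdp_gamma_ge0 mdp)) -mulrA ler_wpM2l ?(mdp_gamma_ge0 mdp) //.
  rewrite normfV normr_nat ler_pdivrMl ?ltr0n //.
  apply: le_trans (ler_norm_sum _ _ _) _.
  apply: (@le_trans _ _ (\sum_(m < M) H)); first by apply: ler_sum.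
  by rewrite sumr_const card_ord mulr_natl.
have hE := HE; move: r1 => /andP[? ?]; rewrite !ler_norml => /andP[? ?].
by apply/andP; split; lra.
Qed.

Lemma noise_var_le n x a : noise_var n x a <= H ^+ 2.
Proof.
have /andP[g0 g1] := gam.
apply: le_trans (variance_le_sqr (mdp_dist mdp x a) (vval_norm n)).
by rewrite ler_piMl ?exprn_ile1 ?(ltW g1) // variance_ge0 //; apply: (mdp_dist mdp).
Qed.

(** Bounding [alpha^2] by [alpha], the geometric sum has mass [1 / (1 - alpha) = H^2]. *)
Lemma acc_var_le n x a : acc_var n x a <= H ^+ 4.
Proof.
have := sqr_horizonE; have -> : H ^+ 4 = H ^+ 2 * H ^+ 2 by rewrite -exprD.
have h2 : 0 <= H ^+ 2 by rewrite sqr_ge0.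
elim: n => [|n IH] /= hh; first by rewrite mulr_ge0.
have := noise_var_le n x a; move/(_ hh): IH.
have := alpha_ge0; have : alpha <= 1 by have := sqr_ge0 (1 - gamma); lra.
move: (noise_var _ _ _) (acc_var _ _ _) => nv av al1 al0 avle nvle.
have -> : H ^+ 2 * H ^+ 2 = H ^+ 2 + alpha * (H ^+ 2 * H ^+ 2).
  by rewrite mulrBl mul1r (mulrA ((1 - gamma) ^+ 2)) hh; ring.
apply: lerD => //.
have h4 : 0 <= H ^+ 2 * H ^+ 2 by rewrite mulr_ge0.
apply: le_trans (ler_wpM2l (sqr_ge0 _) avle) _.
by rewrite ler_wpM2r // expr2 ler_piMr.
Qed.

Section Increment.
Variables (K : nat) (G : X -> R) (b : X -> A -> R) (c : R).
Hypothesis G_ge0 : forall x, 0 <= G x.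
Hypothesis c_ge0 : 0 <= c.
Hypothesis G_super : forall x a, gamma * expect (P x a) G + b x a <= G x.
Hypothesis noise_le : forall k x a, (k < K)%N ->
  `|noise k x a| + (1 - gamma) ^+ 2 * `|acc_noise k x a| <= b x a + c * beta ^+ k.

(** By [score_decomp], [s_(k+1) - s_k] is [alpha^k r + gamma P (w_k - w_(k-1))] plus
    [noise_k - (1 - alpha) acc_noise_k], and taking maxima is nonexpansive. [G] absorbs the source
    [b]; the transients [(1 + c) beta^k] accumulate with factor [1 / (beta - gamma) <= 2 H]. *)
Lemma increment_le k x : (k <= K)%N ->
  `|wval k x - wprev k x| <= G x + 2 * (1 + c) * H * beta ^+ k.
Proof.
elim: k x => [|k IH] x kK.
  rewrite /wval /wprev /= subrr normr0 addr_ge0 // expr0 mulr1.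
  by rewrite !mulr_ge0 // ?addr_ge0 // ltW.
rewrite wprevS !wvalE; apply: maxA_dist => a.
set D := 2 * (1 + c) * H.
have exp_le : `|expect (P x a) (fun y => wval k y - wprev k y)| <=
    expect (P x a) G + D * beta ^+ k.
  have pd := mdp_dist mdp x a.
  have -> : expect (P x a) G + D * beta ^+ k = expect (P x a) (fun y => G y + D * beta ^+ k).
    by rewrite expectD (expect_cst pd).
  rewrite ler_norml -expectN; apply/andP; split; apply: (expect_le pd) => y;
    by have := IH y (ltnW kK); rewrite ler_norml -/D => /andP[]; lra.
have -> : score k.+1 x a - score k x a = alpha ^+ k * r x a
    + gamma * expect (P x a) (fun y => wval k y - wprev k y)
    + (noise k x a - (1 - gamma) ^+ 2 * acc_noise k x a).
  rewrite !score_decomp wprevS expectD expectN (exprS alpha k) /=.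
  apply/eqP; rewrite -subr_eq0; apply/eqP.
  transitivity (((1 - gamma) ^+ 2 * H ^+ 2 - 1) * (alpha ^+ k * r x a)); last first.
    by rewrite sqr_horizonE; ring.
  by ring.
have rle : `|alpha ^+ k * r x a| <= beta ^+ k.
  rewrite normrM ger0_norm ?exprn_ge0 ?alpha_ge0 // -[leRHS]mulr1.
  by rewrite ler_pM ?exprn_ge0 ?alpha_ge0 ?alphaX_le_betaX // ler_norml (mdp_reward mdp).
have nle : `|noise k x a - (1 - gamma) ^+ 2 * acc_noise k x a| <= b x a + c * beta ^+ k.
  apply: le_trans (noise_le x a kK); apply: le_trans (ler_normB _ _) _.
  by rewrite lerD2l normrM ger0_norm ?sqr_ge0.
apply: le_trans (ler_normD _ _) _; apply: le_trans (lerD (ler_normD _ _) nle) _.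
have g0 := mdp_gamma_ge0 mdp.
rewrite (normrM gamma) (ger0_norm g0); have := ler_wpM2l g0 exp_le; have := G_super x a.
have key : (1 + c) * beta ^+ k + gamma * (D * beta ^+ k) <= D * beta ^+ k.+1.
  rewrite (exprS beta k) mulrA (mulrA D) -mulrDl ler_wpM2r ?betaX_ge0 // /D.
  suff hbg : 1 <= 2 * H * (beta - gamma).
    have : 0 <= (1 + c) * (2 * H * (beta - gamma) - 1) by rewrite mulr_ge0 ?subr_ge0 ?addr_ge0.
    by move: beta => b'; lra.
  have -> : 2 * H * (beta - gamma) = 2 * ((1 - gamma) * H) - (1 - gamma) * ((1 - gamma) * H).
    by field; rewrite subr_eq0 eq_sym lt_eqF //; case/andP: gam.
  by rewrite HE; lra.
by move: rle; lra.
Qed.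

End Increment.
End Run.

(** * Error propagation *)

Section ErrorAnalysis.
Variables (R : realType) (X A : finType) (a0 : A) (gamma : R).
Variables (r : X -> A -> R) (P : X -> A -> X -> R).
Hypothesis mdp : is_mdp gamma r P.
Variables (M : nat) (samp : nat -> nat -> X -> A -> X).
Hypothesis M_gt0 : (0 < M)%N.

Local Notation H := ((1 - gamma)^-1).
Local Notation alpha := (1 - (1 - gamma) ^+ 2).
Local Notation beta := (1 - (1 - gamma) ^+ 2 / 2).
Local Notation w := (wval a0 gamma r M samp).
Local Notation wp := (wprev a0 gamma r M samp).
Local Notation v := (vval a0 gamma r M samp).
Local Notation s := (score a0 gamma r M samp).
Local Notation noise := (noise a0 gamma r P M samp).
Local Notation acc_noise := (acc_noise a0 gamma r P M samp).
Local Notation noise_var := (noise_var a0 gamma r P M samp).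
Local Notation acc_var := (acc_var a0 gamma r P M samp).

Variable V : X -> R.
Hypothesis V_opt : bellman_optimal gamma r P V.

Local Notation opt_var := (opt_var gamma P V).
Local Notation U := (var_potential gamma V).

(** The rescaled [w_k / H^2] solves the optimality equation up to a defect with three sources: the
    missing reward mass [alpha^k], the accumulated noise, and [W] for replacing [w_(k-1)] by
    [w_k]. *)
Lemma approx_error k (W : R) (G : X -> R) (d : X -> A) x :
  (forall y, `|w k y - wp k y| <= W) ->
  (forall y a, gamma * expect (P y a) G
     + (alpha ^+ k + (1 - gamma) ^+ 2 * (`|acc_noise k y a| + W)) <= G y) ->
  (forall y a, s k y a <= s k y (d y)) ->
  `|(1 - gamma) ^+ 2 * w k x - V x| <= G x /\
  V x - vpi gamma r P (@detpol R X A d) x <= 2 * G x.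
Proof.
move=> wW GS dP.
have g0 := mdp_gamma_ge0 mdp; have /andP[_ g1] := mdp_gamma mdp.
set u := fun y => (1 - gamma) ^+ 2 * w k y.
set e := fun y a => alpha ^+ k + (1 - gamma) ^+ 2 * (`|acc_noise k y a| + W).
have close y a : `|(1 - gamma) ^+ 2 * s k y a - backup gamma r P u y a| <= e y a.
  have -> : (1 - gamma) ^+ 2 * s k y a - backup gamma r P u y a =
     - (alpha ^+ k * r y a) + (1 - gamma) ^+ 2 * acc_noise k y a
     - gamma * ((1 - gamma) ^+ 2 * expect (P y a) (fun z => w k z - wp k z)).
    apply/eqP; rewrite -subr_eq0; apply/eqP.
    transitivity (((1 - gamma) ^+ 2 * H ^+ 2 - 1) * ((1 - alpha ^+ k) * r y a)); last first.
      by rewrite (sqr_horizonE mdp); ring.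
    rewrite (score_decomp a0 mdp) /backup expectZ expectD expectN; ring.
  have rle : `|alpha ^+ k * r y a| <= alpha ^+ k.
    rewrite normrM ger0_norm ?exprn_ge0 ?(alpha_ge0 mdp) // ler_piMr //.
      by rewrite exprn_ge0 ?(alpha_ge0 mdp).
    by rewrite ler_norml (mdp_reward mdp).
  have Wle : `|gamma * ((1 - gamma) ^+ 2 * expect (P y a) (fun z => w k z - wp k z))|
      <= (1 - gamma) ^+ 2 * W.
    rewrite normrM (ger0_norm g0) -[leRHS]mul1r; apply: ler_pM => //; first exact: ltW.
    rewrite normrM ger0_norm ?sqr_ge0 // ler_wpM2l ?sqr_ge0 //.
    by apply: expect_norm_le wW; exact: mdp_dist mdp _ _.
  apply: le_trans (ler_normB _ _) _; rewrite /e mulrDr addrA; apply: lerD => //.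
  apply: le_trans (ler_normD _ _) _; rewrite normrN; apply: lerD => //.
  by rewrite normrM ger0_norm ?sqr_ge0.
have uE y : u y = (1 - gamma) ^+ 2 * s k y (d y).
  by rewrite /u wvalE (maxA_greedy a0 (dP y)).
apply: (approx_greedy_error mdp V_opt (u := u) (eps := e) (G := G) (d := d) _ _ _ x) => // [y a|y].
  have := close y a; rewrite uE ler_norml => /andP[? _].
  have := ler_wpM2l (sqr_ge0 (1 - gamma)) (dP y a).
  by lra.
by have := close y (d y); rewrite -uE ler_norml => /andP[_ ?]; lra.
Qed.

Variables (g eta : R) (K : nat).
Hypothesis g_gt0 : 0 < g.
Hypothesis g_sqr : g ^+ 2 = H.
Hypothesis eta_ge0 : 0 <= eta.
Hypothesis eta_le : 256 * eta * H <= 1.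
(** The three deviation bounds share the form [eta * (2 * W / (H * B) + B)], with [B] equal to [g],
    1 and [H]. The scale [g = sqrt H] balances the two terms under the worst-case variance [H^2];
    the other two suit variances compared with [opt_var]. *)
Hypothesis noise_crude : forall k x a, (k < K)%N ->
  `|noise k x a| <= eta * (2 * noise_var k x a / (g * H) + g).
Hypothesis noise_fine : forall k x a, (k < K)%N ->
  `|noise k x a| <= eta * (2 * noise_var k x a / H + 1).
Hypothesis acc_fine : forall k x a, (k <= K)%N ->
  `|acc_noise k x a| <= eta * (2 * acc_var k x a / H ^+ 2 + H).

Let HE : (1 - gamma) * H = 1. Proof. exact: horizonE mdp. Qed.
Let H1 : 1 <= H. Proof. exact: horizon_ge1 mdp. Qed.
Let H0 : 0 < H. Proof. exact: horizon_gt0 mdp. Qed.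
Let b0 k : 0 <= beta ^+ k. Proof. exact: betaX_ge0 mdp k. Qed.

Let g_ge1 : 1 <= g.
Proof. by rewrite -(@expr_ge1 _ 2) ?g_sqr // ltW. Qed.

Let g_le : g <= H.
Proof. by rewrite -g_sqr expr2 ler_peMr // ltW. Qed.

Lemma noise_le_crude k x a : (k < K)%N -> `|noise k x a| <= 3 * g * eta.
Proof.
move=> kK; apply: le_trans (noise_crude x a kK) _.
rewrite mulrC ler_wpM2r //.
have gH0 : 0 < g * H by rewrite mulr_gt0.
suff : 2 * noise_var k x a / (g * H) <= 2 * g by lra.
rewrite ler_pdivrMr // -mulrA ler_pM2l // mulrA -expr2 g_sqr -expr2.
exact: noise_var_le.
Qed.

Lemma acc_noise_le_crude k x a : (k <= K)%N -> `|acc_noise k x a| <= 3 * H ^+ 2 * eta.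
Proof.
move=> kK; apply: le_trans (acc_fine x a kK) _.
rewrite mulrC ler_wpM2r //.
have h2 : H <= H ^+ 2 by rewrite expr2 ler_peMr // ltW.
suff : 2 * acc_var k x a / H ^+ 2 <= 2 * H ^+ 2 by lra.
rewrite ler_pdivrMr ?exprn_gt0 // -mulrA ler_pM2l // -exprD.
exact: acc_var_le.
Qed.

Let acc_scaled_le k x a : (k <= K)%N ->
  (1 - gamma) ^+ 2 * `|acc_noise k x a| <= 3 * eta.
Proof.
move=> kK; apply: le_trans (ler_wpM2l (sqr_ge0 _) (acc_noise_le_crude x a kK)) _.
rewrite le_eqVlt; apply/orP; left; apply/eqP.
transitivity (((1 - gamma) ^+ 2 * H ^+ 2) * (3 * eta)); first by ring.
by rewrite (sqr_horizonE mdp) mul1r.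
Qed.

(** First pass, with a constant potential: the source is at most [3 g eta + 3 eta <= 6 g eta], and
    discounting multiplies it by [H]. *)
Lemma wdiff_le_crude k x : (k <= K)%N ->
  `|w k x - wp k x| <= 6 * g * eta * H + 2 * H * beta ^+ k.
Proof.
move=> kK.
have := @increment_le R X A a0 gamma r P mdp M samp K (fun=> 6 * g * eta * H)
  (fun _ _ => 6 * g * eta) 0.
have gn : 0 <= 6 * g * eta by rewrite !mulr_ge0 // ltW.
have -> : 2 * H * beta ^+ k = 2 * (1 + 0) * H * beta ^+ k by ring.
apply=> // [y|y a|j y a jK]; first by rewrite mulr_ge0 // ltW.
  rewrite (expect_cst (mdp_dist mdp y a)).
  have -> : gamma * (6 * g * eta * H) + 6 * g * eta = 6 * g * eta * (gamma * H + 1) by ring.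
  by have -> : gamma * H + 1 = H by have := HE; lra.
have := noise_le_crude y a jK; have := acc_scaled_le y a (ltnW jK).
by have := g_ge1; have := eta_ge0; nra.
Qed.

Lemma value_dist k x : (k <= K)%N ->
  `|(1 - gamma) ^+ 2 * w k x - V x| <= 3 * H * beta ^+ k + 9 * H * eta.
Proof.
(* Any greedy choice will do here, since only the value estimate of [approx_error] is kept. *)
move=> kK; pose d y := [arg max_(a > a0) s k y a]%O.
have dP y a : s k y a <= s k y (d y).
  by rewrite /d; case: arg_maxP => // b _; apply.
apply: (proj1 (approx_error (G := fun=> 3 * H * beta ^+ k + 9 * H * eta) x
  (fun y => wdiff_le_crude y kK) _ dP)) => y a.
rewrite (expect_cst (mdp_dist mdp y a)).
have := acc_scaled_le y a kK; have := alphaX_le_betaX mdp k.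
move: (alpha ^+ k) (beta ^+ k) (b0 k) => al b bb alb.
rewrite (mulrDr ((1 - gamma) ^+ 2)); move: (_ * `|_|) => E EE.
have -> : (1 - gamma) ^+ 2 * (6 * g * eta * H + 2 * H * b) =
    (1 - gamma) * (6 * g * eta) + (1 - gamma) * 2 * b.
  transitivity (((1 - gamma) * H) * ((1 - gamma) * (6 * g * eta) + (1 - gamma) * 2 * b)).
    by ring.
  by rewrite HE mul1r.
set Z := 3 * H * b + 9 * H * eta.
have ZE : Z = gamma * Z + (3 * b + 9 * eta).
  transitivity (gamma * Z + ((1 - gamma) * H) * (3 * b + 9 * eta)); first by rewrite /Z; ring.
  by rewrite HE mul1r.
(* The increment enters the defect scaled by [(1 - gamma)^2]; one factor cancels its [H], the other
   its [g], so it costs only [6 eta]. *)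
have cg : (1 - gamma) * g <= 1.
  rewrite -[leRHS]HE ler_wpM2l // subr_ge0 ltW //.
  by case/andP: (mdp_gamma mdp).
have : (1 - gamma) * g * eta <= eta by rewrite ler_piMl.
have : (1 - gamma) * b <= b by rewrite ler_piMl // gerBl; exact: mdp_gamma_ge0 mdp.
by move=> cb cge; rewrite [leRHS]ZE lerD2l; lra.
Qed.

(** [v_k] is [w_k / H^2] plus [alpha] times the increment. The two crude bounds leave at most
    [15 g eta H], which [256 eta H <= 1] brings below [g]. *)
Lemma vval_dist k x : (k <= K)%N -> `|v k x - V x| <= g + 5 * H * beta ^+ k.
Proof.
move=> kK.
have -> : v k x - V x = alpha * (w k x - wp k x) + ((1 - gamma) ^+ 2 * w k x - V x).
  by rewrite /vval; ring.
apply: le_trans (ler_normD _ _) _.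
have : `|alpha * (w k x - wp k x)| <= 6 * g * eta * H + 2 * H * beta ^+ k.
  rewrite normrM (ger0_norm (alpha_ge0 mdp)) -[leRHS]mul1r.
  by apply: ler_pM (wdiff_le_crude x kK); rewrite ?(alpha_ge0 mdp) ?gerBl ?sqr_ge0.
have := value_dist x kK.
have eH : g * (256 * eta * H) <= g by rewrite ler_piMr // ltW.
have : eta * H <= g * (eta * H) by rewrite ler_peMl // mulr_ge0 // ltW.
have : 0 <= g * (eta * H) by rewrite !mulr_ge0 // ltW.
by lra.
Qed.

(** The distance [g] enters squared, costing only order [g^2 = H] instead of the worst-case
    [H^2]. *)
Lemma noise_var_le_opt k x a : (k <= K)%N ->
  noise_var k x a <= 2 * opt_var x a + 4 * H + 100 * H ^+ 2 * beta ^+ k.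
Proof.
move=> kK.
have := variance_perturb (mdp_dist mdp x a) (fun y => vval_dist y kK).
move/(ler_wpM2l (sqr_ge0 gamma)) => h; apply: le_trans h _.
have gg : gamma ^+ 2 <= 1.
  by case/andP: (mdp_gamma mdp) => ? ?; rewrite exprn_ile1 // ltW.
set z := g + _; have z2 : z ^+ 2 <= 2 * H + 50 * H ^+ 2 * beta ^+ k.
  rewrite -{1}g_sqr /z; have : 0 <= (g - 5 * H * beta ^+ k) ^+ 2 by exact: sqr_ge0.
  have : (H * beta ^+ k) ^+ 2 <= H ^+ 2 * beta ^+ k.
    by rewrite exprMn ler_wpM2l ?sqr_ge0 // expr2 ler_piMr // (betaX_le1 mdp).
  by lra.
rewrite mulrDr mulrCA -/(opt_var x a) -addrA lerD2l mulrCA.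
have : gamma ^+ 2 * z ^+ 2 <= z ^+ 2 by rewrite ler_piMl // sqr_ge0.
by lra.
Qed.

Let q_ge0 x a : 0 <= 2 * opt_var x a + 4 * H.
Proof. by have := opt_var_ge0 mdp V x a; have := H0; lra. Qed.

Lemma acc_var_le_opt k x a : (k <= K)%N ->
  acc_var k x a <= H ^+ 2 * (2 * opt_var x a + 4 * H) + 200 * H ^+ 4 * beta ^+ k.
Proof.
have q0 := q_ge0 x a; set q := 2 * _ + _ in q0 *.
have h2 : 0 <= H ^+ 2 by rewrite sqr_ge0.
have h4 : 0 <= 200 * H ^+ 4 by rewrite mulr_ge0 ?exprn_ge0 // ltW.
elim: k => [|k IH] kK /=.
  by rewrite addr_ge0 // mulr_ge0 // (b0 0).
have nv : noise_var k x a <= q + 100 * H ^+ 2 * beta ^+ k.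
  exact: noise_var_le_opt (ltnW kK).
set B := H ^+ 2 * q + 200 * H ^+ 4 * beta ^+ k.
have av : alpha ^+ 2 * acc_var k x a <= alpha * B.
  apply: le_trans (ler_wpM2l (sqr_ge0 _) (IH (ltnW kK))) _; rewrite -/B.
  have B0 : 0 <= B by rewrite addr_ge0 // mulr_ge0.
  rewrite ler_wpM2r // expr2 ler_piMr ?(alpha_ge0 mdp) //.
  by rewrite gerBl sqr_ge0.
apply: le_trans (lerD nv av) _.
rewrite le_eqVlt; apply/orP; left; apply/eqP.
apply/eqP; rewrite -subr_eq0; apply/eqP.
(* The induction closes with equality: [(1 - alpha) H^2 = 1] for the stationary part, and
   [200 = 100 * 2] because [1 / (beta - alpha) = 2 H^2]. *)
transitivity ((1 - (1 - gamma) ^+ 2 * H ^+ 2) * (q + 100 * H ^+ 2 * beta ^+ k)).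
  rewrite /B (exprS beta k); move: (beta ^+ k) => b; move: H => h; by field.
by rewrite (sqr_horizonE mdp); ring.
Qed.

Let eta_le_b k c : 0 <= c <= 256 -> c * eta * H * beta ^+ k <= beta ^+ k.
Proof.
move=> /andP[c0 c1]; rewrite ler_piMl //; apply: le_trans eta_le.
by rewrite -!mulrA ler_wpM2r // mulr_ge0 // ltW.
Qed.

Lemma noise_le_fine k x a : (k < K)%N ->
  `|noise k x a| + (1 - gamma) ^+ 2 * `|acc_noise k x a|
    <= eta * (4 * opt_var x a * (1 - gamma) + 12) + 1 * beta ^+ k.
Proof.
move=> kK; have := noise_fine x a kK; have := acc_scaled_le x a (ltnW kK).
have := eta_le_b k (c := 200) ltac:(lra).
have := noise_var_le_opt x a (ltnW kK); rewrite invrK.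
have c0 : 0 <= 1 - gamma by rewrite subr_ge0 ltW //; case/andP: (mdp_gamma mdp).
move/(ler_wpM2r c0).
have -> : (2 * opt_var x a + 4 * H + 100 * H ^+ 2 * beta ^+ k) * (1 - gamma) =
   2 * opt_var x a * (1 - gamma) + 4 * ((1 - gamma) * H)
   + 100 * ((1 - gamma) * H) * H * beta ^+ k by ring.
rewrite HE !mulr1 => /(ler_wpM2l eta_ge0).
by move: H (beta ^+ k) => h b ? ? ? ?; lra.
Qed.

(** Second pass: the source now involves [opt_var], so a multiple of [U] is a potential. With
    [U <= 5 H^2] it gives [20 + 12 = 32], and the factor [g] of the crude bound disappears. *)
Lemma wdiff_le_fine k x : (k <= K)%N ->
  `|w k x - wp k x| <= 32 * eta * H + 4 * H * beta ^+ k.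
Proof.
move=> kK.
pose G y := eta * (4 * (1 - gamma) * U y + 12 * H).
have c0 : 0 <= 1 - gamma by rewrite subr_ge0 ltW //; case/andP: (mdp_gamma mdp).
have GE y a : gamma * expect (P y a) G + eta * (4 * opt_var y a * (1 - gamma) + 12) <= G y.
  rewrite /G expectZ expectD expectZ (expect_cst (mdp_dist mdp y a)).
  have := var_potential_super a0 mdp V_opt y a.
  move/(ler_wpM2l c0)/(ler_wpM2l eta_ge0).
  move: (expect _ _) (opt_var _ _) (U y) => e o u.
  have -> : eta * (4 * (1 - gamma) * u + 12 * H) =
     eta * (4 * (1 - gamma) * u + 12 * (gamma * H) + 12 * ((1 - gamma) * H)) by ring.
  rewrite HE; lra.
have G0 y : 0 <= G y.
  rewrite mulr_ge0 // addr_ge0 //; last by rewrite mulr_ge0 // ltW.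
  by rewrite mulr_ge0 ?mulr_ge0 // (var_potential_ge0 a0 mdp V_opt).
have := increment_le mdp G0 ler01 GE noise_le_fine x kK.
have -> : 2 * (1 + 1) * H * beta ^+ k = 4 * H * beta ^+ k by ring.
move/le_trans; apply; rewrite lerD2r /G.
have := ler_wpM2l c0 (var_potential_le gamma V x).
have -> : (1 - gamma) * (5 * H ^+ 2) = 5 * H * ((1 - gamma) * H) by ring.
rewrite HE mulr1 => /(ler_wpM2l eta_ge0).
by move: H (U x) => h u ?; lra.
Qed.

Lemma mdvi_suboptimality (d : X -> A) x :
  (forall y a, s K y a <= s K y (d y)) ->
  V x - vpi gamma r P (@detpol R X A d) x <= 14 * H * beta ^+ K + 122 * eta.
Proof.
move=> dP.
(* The transients add up to [1 + 2 + 4 = 7] (reward mass, accumulated noise, increment), and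
   [41 = 9 + 32] (accumulated noise, increment). With [U <= 5 H^2], doubling [G] gives
   [14 H beta^K + 122 eta]. *)
pose G y := 7 * H * beta ^+ K + (1 - gamma) ^+ 2 * eta * (4 * U y + 41 * H ^+ 2).
have c0 : 0 <= 1 - gamma by rewrite subr_ge0 ltW //; case/andP: (mdp_gamma mdp).
have c1 : 1 - gamma <= 1 by rewrite gerBl (mdp_gamma_ge0 mdp).
have cE : (1 - gamma) ^+ 2 * H ^+ 2 = 1 := sqr_horizonE mdp.
have cE' : (1 - gamma) ^+ 2 * H = 1 - gamma by rewrite expr2 -mulrA HE mulr1.
have GE y a : gamma * expect (P y a) G + (alpha ^+ K + (1 - gamma) ^+ 2 *
    (`|acc_noise K y a| + (32 * eta * H + 4 * H * beta ^+ K))) <= G y.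
  have accle : (1 - gamma) ^+ 2 * `|acc_noise K y a| <=
      (1 - gamma) ^+ 2 * eta * (4 * opt_var y a + 9 * H) + 2 * beta ^+ K.
    have := acc_fine y a (leqnn K); have := acc_var_le_opt y a (leqnn K).
    have -> : (H ^+ 2)^-1 = (1 - gamma) ^+ 2 by rewrite exprVn invrK.
    move/(ler_wpM2r (sqr_ge0 (1 - gamma))) => av.
    have {}av : acc_var K y a * (1 - gamma) ^+ 2 <=
        2 * opt_var y a + 4 * H + 200 * H ^+ 2 * beta ^+ K.
      apply: le_trans av _; rewrite le_eqVlt; apply/orP; left; apply/eqP.
      transitivity (((1 - gamma) ^+ 2 * H ^+ 2) *
         (2 * opt_var y a + 4 * H + 200 * H ^+ 2 * beta ^+ K)).
        by ring.
      by rewrite cE mul1r.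
    move=> ac; have {}ac : `|acc_noise K y a| <=
       eta * (4 * opt_var y a + 9 * H) + eta * 400 * H ^+ 2 * beta ^+ K.
      by have := ler_wpM2l eta_ge0 av; lra.
    apply: le_trans (ler_wpM2l (sqr_ge0 (1 - gamma)) ac) _.
    rewrite mulrDr mulrA lerD2l.
    have -> : (1 - gamma) ^+ 2 * (eta * 400 * H ^+ 2 * beta ^+ K) =
       ((1 - gamma) ^+ 2 * H ^+ 2) * (400 * eta * beta ^+ K) by ring.
    rewrite cE mul1r ler_wpM2r //.
    have : eta <= eta * H by rewrite ler_peMr.
    by have := eta_le; move: H => h; lra.
  have EG : expect (P y a) G = 7 * H * beta ^+ K
      + (1 - gamma) ^+ 2 * eta * (4 * expect (P y a) U + 41 * H ^+ 2).
    have pd := mdp_dist mdp y a.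
    by rewrite /G expectD (expect_cst pd) expectZ expectD (expect_cst pd) expectZ.
  have := ler_wpM2l (mulr_ge0 (sqr_ge0 (1 - gamma)) eta_ge0)
    (var_potential_super a0 mdp V_opt y a).
  have := alphaX_le_betaX mdp K; have := ler_wpM2r (b0 K) c1.
  rewrite EG /G.
  move: accle; rewrite (mulrDr ((1 - gamma) ^+ 2) `|_|).
  move: (_ * `|_|) (expect _ _) (opt_var _ _) (U y) (alpha ^+ K) (beta ^+ K) =>
    E e o u al b.
  have -> : (1 - gamma) ^+ 2 * (32 * eta * H + 4 * H * b) =
    (1 - gamma) ^+ 2 * eta * (32 * H) + 4 * (((1 - gamma) ^+ 2 * H) * b) by ring.
  rewrite cE'.
  set t := (1 - gamma) ^+ 2 * eta.
  have -> : t * (32 * H) = 32 * (t * H) by ring.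
  have -> : t * (4 * o + 9 * H) = 4 * (t * o) + 9 * (t * H) by ring.
  rewrite !(mulrDr t) !(mulrCA t 41).
  set z := 7 * H * b; have zE : z = gamma * z + 7 * b.
    transitivity (gamma * z + 7 * ((1 - gamma) * H) * b); first by rewrite /z; ring.
    by rewrite HE mulr1.
  have tE : t * H ^+ 2 = gamma * (t * H ^+ 2) + t * H.
    transitivity (gamma * (t * H ^+ 2) + t * H * ((1 - gamma) * H)); first by ring.
    by rewrite HE mulr1.
  clearbody z t; move: (t * H) (t * H ^+ 2) tE => tH tH2 tE *; lra.
have [_ h] := approx_error x (fun y => wdiff_le_fine y (leqnn K)) GE dP.
apply: le_trans h _; rewrite /G.
have := ler_wpM2l (mulr_ge0 (sqr_ge0 (1 - gamma)) eta_ge0) (var_potential_le gamma V x).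
have : (1 - gamma) ^+ 2 * eta * H ^+ 2 = eta by rewrite mulrAC cE mul1r.
set t := (1 - gamma) ^+ 2 * eta.
by lra.
Qed.

End ErrorAnalysis.

(** * Product laws *)

Section OneStep.
Variables (R : realType) (Y : finType).

(** [expR x <= 1 / (1 - x)], and [(1 - x) (1 + x + 2 x^2) = 1 + x^2 (1 - 2 x) >= 1]. *)
Lemma expR_le_quadratic (x : R) : x <= 1 / 2 -> expR x <= 1 + x + 2 * x ^+ 2.
Proof.
move=> x2; have x1 : 0 < 1 - x by lra.
have : expR x <= (1 - x)^-1.
  by rewrite -[leLHS]invrK -expRN lef_pV2 ?posrE ?expR_gt0 // expR_ge1Dx.
move/le_trans; apply; rewrite -[leLHS]mul1r ler_pdivrMr //.
by have := sqr_ge0 x; rewrite expr2; nra.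
Qed.

(** One-step Bernstein estimate: [4 |t| h <= 1] keeps the exponent below 1/2, the linear term
    averages to zero, and the quadratic one is compensated by [1 + z <= expR z]. *)
Lemma expect_expR_centered_le1 (p f : Y -> R) (h t : R) :
  is_dist p -> (forall y, `|f y| <= h) -> 4 * `|t| * h <= 1 ->
  expect p (fun y => expR (t * (f y - expect p f) - 2 * t ^+ 2 * variance p f)) <= 1.
Proof.
move=> pd fh th; set m := expect p f; set s2 := variance p f.
have mh := expect_norm_le pd fh; rewrite -/m in mh.
have -> : (fun y => expR (t * (f y - m) - 2 * t ^+ 2 * s2)) =
    (fun y => expR (- (2 * t ^+ 2 * s2)) * expR (t * (f y - m))).
  by apply/funext => y; rewrite -expRD addrC.
rewrite expectZ expRN mulrC ler_pdivrMr ?expR_gt0 // mul1r.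
apply: (@le_trans _ _ (1 + 2 * t ^+ 2 * s2)); last exact: expR_ge1Dx.
have -> : 1 + 2 * t ^+ 2 * s2 =
    expect p (fun y => (1 - t * m) + (t * f y + 2 * t ^+ 2 * (f y - m) ^+ 2)).
  by rewrite expectD (expect_cst pd) expectD !expectZ /s2 /variance -/m; ring.
apply: (expect_le pd) => y.
apply: le_trans (expR_le_quadratic _) _; last by lra.
apply: le_trans (ler_norm _) _; rewrite normrM.
have : `|f y - m| <= 2 * h by have := ler_normB (f y) m; have := fh y; lra.
by move/(ler_wpM2l (normr_ge0 t)); lra.
Qed.

End OneStep.

Section ProductLaw.
Variables (R : realType) (I Y : finType) (p : I -> Y -> R).
Hypothesis p_dist : forall i, is_dist (p i).
Local Notation Om := {ffun I -> Y}.

Definition product_law (om : Om) : R := \prod_i p i (om i).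

Definition resample (om : Om) i y : Om := [ffun j => if j == i then y else om j].

Lemma resampleE om i y j : resample om i y j = if j == i then y else om j.
Proof. by rewrite ffunE. Qed.

Lemma product_law_ge0 om : 0 <= product_law om.
Proof. by apply: prodr_ge0 => i _; exact: (proj1 (p_dist i)). Qed.

Lemma product_law_dist : is_dist product_law.
Proof.
split; first exact: product_law_ge0.
rewrite -(bigA_distr_bigA (fun i y => p i y)) /=.
by rewrite big1 // => i _; exact: (proj2 (p_dist i)).
Qed.

Lemma product_law_resample om i y :
  product_law om * p i y = product_law (resample om i y) * p i (om i).
Proof.
rewrite /product_law (bigD1 i) //= [in RHS](bigD1 i) //= resampleE eqxx.
rewrite mulrAC [in RHS]mulrAC [p i y * _]mulrC; congr (_ * _).
by apply: eq_bigr => j /negbTE ji; rewrite resampleE ji.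
Qed.

(** Exchanging coordinate [i] with an independent copy is an involution preserving the joint law. *)
Lemma expect_resample i F :
  expect product_law F =
  expect product_law (fun om => expect (p i) (fun y => F (resample om i y))).
Proof.
pose swap (z : Om * Y) := (resample z.1 i z.2, z.1 i).
have swapK : involutive swap.
  case=> om y; rewrite /swap /= resampleE eqxx; congr pair.
  by apply/ffunP => j; rewrite !resampleE; case: eqP => // ->.
rewrite /expect; under [in RHS]eq_bigr => om _ do rewrite big_distrr.
rewrite pair_big /= (reindex_inj (inv_inj swapK)) /=.
rewrite -(pair_big xpredT xpredT (fun om y => product_law (resample om i y) *
   (p i (om i) * F (resample (resample om i y) i (om i))))) /=.
under [in RHS]eq_bigr => om _.
  under eq_bigr => y _.
    rewrite mulrA -product_law_resample.
    have -> : resample (resample om i y) i (om i) = om.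
      by have [] := swapK (om, y).
    rewrite mulrAC; over.
  rewrite -big_distrr /= (proj2 (p_dist i)) mulr1; over.
by [].
Qed.

(* Peel off the factors by decreasing rank: averaging over coordinate [i] leaves the
   factors of rank at most [rho i] other than the [i]-th one unchanged. *)
Lemma expect_prod_le1 (rho : I -> nat) (xi : I -> Om -> R) :
  (forall i om, 0 <= xi i om) ->
  (forall i j om y, i != j -> (rho i <= rho j)%N -> xi i (resample om j y) = xi i om) ->
  (forall i om, expect (p i) (fun y => xi i (resample om i y)) <= 1) ->
  expect product_law (fun om => \prod_i xi i om) <= 1.
Proof.
move=> xi0 xi_adapted xi_le1.
suff h n (S : {set I}) : #|S| = n -> expect product_law (fun om => \prod_(i in S) xi i om) <= 1.
  by have := h _ [set: I] erefl; under eq_fun => om do under eq_bigl => i do rewrite inE.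
elim: n S => [|n IH] S Sn.
  move/eqP: Sn; rewrite cards_eq0 => /eqP ->.
  under eq_fun => om do rewrite big_set0.
  by rewrite (expect_cst product_law_dist).
have [i1 i1S] : exists i, i \in S by apply/set0Pn; rewrite -cards_eq0 Sn.
have [i0 i0S i0max] := @arg_maxnP _ i1 (mem S) rho i1S.
rewrite (expect_resample i0); apply: le_trans (IH (S :\ i0) _); last first.
  by move: Sn; rewrite (cardsD1 i0) [i0 \in S]i0S => -[].
apply: (expect_le product_law_dist) => om.
have -> : (fun y => \prod_(i in S) xi i (resample om i0 y)) =
    (fun y => \prod_(i in S :\ i0) xi i om * xi i0 (resample om i0 y)).
  apply/funext => y; rewrite (big_setD1 i0) //= mulrC; congr (_ * _).
  apply: eq_bigr => i; rewrite !inE => /andP[ii0 iS].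
  by rewrite xi_adapted //; exact: i0max.
by rewrite expectZ ler_piMr // prodr_ge0.
Qed.

(** Markov and union bound in one: outside [E] some [F j] reaches [L], so the failure indicator is
    at most the sum of the [expR (F j - L)]. *)
Lemma union_bound (J : finType) (F : J -> Om -> R) (L : R) (E : pred Om) :
  (forall j, expect product_law (fun om => expR (F j om)) <= 1) ->
  (forall om, (forall j, F j om < L) -> E om) ->
  1 - #|J|%:R * expR (- L) <= \sum_(om | E om) product_law om.
Proof.
move=> F1 FE.
have := proj2 product_law_dist; rewrite (bigID E) /= => /(canRL (addrK _)) ->.
rewrite lerD2l lerN2.
apply: (@le_trans _ _ (expect product_law (fun om => \sum_j expR (F j om - L)))).
  rewrite /expect [leRHS](bigID E) /= -[leLHS]add0r; apply: lerD.
    by apply: sumr_ge0 => om _; rewrite mulr_ge0 ?product_law_ge0 ?sumr_ge0 // => j _; rewrite expR_ge0.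
  apply: ler_sum => om nE; rewrite -[leLHS]mulr1 ler_wpM2l ?product_law_ge0 //.
  have [j FjL] : exists j, L <= F j om.
    apply/existsP; rewrite -[X in is_true X]negbK negb_exists; apply/negP => /forallP h.
    by case/negP: nE; apply: FE => j; rewrite ltNge.
  rewrite (bigD1 j) //= -[leLHS]addr0; apply: lerD.
    by rewrite -expR0 ler_expR subr_ge0.
  by apply: sumr_ge0 => i _; rewrite expR_ge0.
have -> : expect product_law (fun om => \sum_j expR (F j om - L)) =
    \sum_j expR (- L) * expect product_law (fun om => expR (F j om)).
  rewrite /expect; under eq_bigr => om _ do rewrite big_distrr.
  rewrite exchange_big; apply: eq_bigr => j _ /=; rewrite big_distrr; apply: eq_bigr => om _ /=.
  by rewrite expRD mulrA mulrC.
rewrite mulr_natl -sumr_const; apply: ler_sum => j _.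
by rewrite ler_piMr ?expR_ge0.
Qed.

End ProductLaw.

(** * Concentration of the sampling noise *)

Section Concentration.
Variables (R : realType) (X A : finType) (a0 : A) (gamma : R).
Variables (r : X -> A -> R) (P : X -> A -> X -> R).
Hypothesis mdp : is_mdp gamma r P.
Variables (K M : nat).
Hypothesis M_gt0 : (0 < M)%N.

Local Notation H := ((1 - gamma)^-1).
Local Notation alpha := (1 - (1 - gamma) ^+ 2).
Local Notation I := ('I_K * 'I_M * X * A)%type.
Local Notation law := (product_law (fun i : I => P i.1.2 i.2)).
Local Notation v om := (vval a0 gamma r M (samp_of om)).
Local Notation noise_at om := (noise a0 gamma r P M (samp_of om)).
Local Notation acc_noise om := (acc_noise a0 gamma r P M (samp_of om)).
Local Notation noise_var_at om := (noise_var a0 gamma r P M (samp_of om)).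
Local Notation acc_var om := (acc_var a0 gamma r P M (samp_of om)).

Lemma samp_of_ord (om : Omega X A K M) (k : 'I_K) (m : 'I_M) x a :
  samp_of om k m x a = om (k, m, x, a).
Proof. by rewrite /samp_of !valK. Qed.

Lemma samp_of_resample (om : Omega X A K M) (i : I) y k m x a :
  (k < i.1.1.1)%N -> samp_of (resample om i y) k m x a = samp_of om k m x a.
Proof.
move=> ki; rewrite /samp_of; case: insubP => // k' _ kE; case: insubP => // m' _ _.
by rewrite resampleE; case: eqP => // iE; move: ki; rewrite -iE /= kE ltnn.
Qed.

(** Predictability: [v_k] depends only on samples from iterations before [k]. *)
Lemma vval_resample (om : Omega X A K M) (i : I) y k : (k <= i.1.1.1)%N ->
  v (resample om i y) k = v om k.
Proof.
suff h : (k <= i.1.1.1)%N ->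
    mdvi a0 alpha gamma r M (samp_of (resample om i y)) k = mdvi a0 alpha gamma r M (samp_of om) k.
  by move=> ki; rewrite /vval /wval /wprev h.
elim: k => [//|k IH] ki /=; rewrite IH ?(ltnW ki) //; congr mdvi_step.
by apply/funext => m; apply/funext => x; apply/funext => a; exact: samp_of_resample.
Qed.

(** The exponential factors into one term per sample, ranked by iteration for [expect_prod_le1];
    samples at other pairs contribute the factor 1. Each term is a one-step Bernstein factor with
    parameter [th k], whose range condition is [4 * lam * H <= M]. *)
Lemma expect_expR_noise_le1 (c : nat -> R) (lam : R) (x : X) (a : A) :
  (forall k, `|c k| <= 1) -> 0 <= lam -> 4 * lam * H <= M%:R ->
  expect law (fun om => expR (lam * (\sum_(k < K) c k * noise_at om k x a)
     - 2 * lam ^+ 2 / M%:R * (\sum_(k < K) c k ^+ 2 * noise_var_at om k x a))) <= 1.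
Proof.
move=> c1 lam0 lamM.
have M0 : 0 < M%:R :> R by rewrite ltr0n.
have pd (i : I) : is_dist (P i.1.2 i.2) by exact: (mdp_dist mdp).
pose th (k : nat) := lam * c k * gamma / M%:R.
pose phi (om : Omega X A K M) (i : I) (y : X) :=
  if (i.1.2 == x) && (i.2 == a) then
    th i.1.1.1 * (v om i.1.1.1 y - expect (P i.1.2 i.2) (v om i.1.1.1))
     - 2 * th i.1.1.1 ^+ 2 * variance (P i.1.2 i.2) (v om i.1.1.1)
  else 0.
have := @expect_prod_le1 R I X _ pd (fun i => i.1.1.1 : nat) (fun i om => expR (phi om i (om i))).
have -> : (fun om : Omega X A K M => \prod_i expR (phi om i (om i))) =
    (fun om => expR (lam * (\sum_(k < K) c k * noise_at om k x a)
     - 2 * lam ^+ 2 / M%:R * (\sum_(k < K) c k ^+ 2 * noise_var_at om k x a))).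
  apply/funext => om; rewrite -expR_sum; congr expR.
  have pairE (T1 T2 : finType) (F : T1 * T2 -> R) : \sum_i F i = \sum_u \sum_z F (u, z).
    by rewrite pair_bigA; apply: eq_bigr => -[].
  rewrite !pairE.
  rewrite !big_distrr /= -sumrB; apply: eq_bigr => k _.
  transitivity (\sum_(m < M) (th k * (v om k (samp_of om k m x a) - expect (P x a) (v om k))
      - 2 * th k ^+ 2 * variance (P x a) (v om k))).
    apply: eq_bigr => m _.
    rewrite (bigD1 x) //= [X in _ + X]big1 ?addr0; last first.
      by move=> z /negbTE zx; rewrite big1 // => b _; rewrite /phi /= zx.
    rewrite (bigD1 a) //= [X in _ + X]big1 ?addr0; last first.
      by move=> b /negbTE ba; rewrite /phi /= ba andbF.
    by rewrite /phi /= !eqxx samp_of_ord.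
  rewrite sumrB -big_distrr sumrB !sumr_const !card_ord /= /noise /noise_var /th.
  move: (expect _ _) (variance _ _) (\sum_(i < M) _) => e s2 S.
  rewrite -[e *+ M]mulr_natl -[(_ * s2) *+ M]mulr_natl.
  by move: (M%:R) M0 => N N0; field; rewrite gt_eqF.
apply=> [i om|i j om y ij rij|i om]; first exact: expR_ge0.
  by rewrite /phi vval_resample // resampleE (negbTE ij).
have -> : (fun y => expR (phi (resample om i y) i (resample om i y i))) =
    (fun y => expR (phi om i y)).
  by apply/funext => y; rewrite /phi vval_resample // resampleE eqxx.
rewrite /phi; case: ((i.1.2 == x) && (i.2 == a)); last by rewrite (expect_cst (pd i)) expR0.
apply: (expect_expR_centered_le1 (h := H)) => // [y|].
  exact: (vval_norm a0 mdp _ M_gt0).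
have : `|th i.1.1.1| <= lam / M%:R.
  rewrite /th !normrM (ger0_norm lam0) (ger0_norm (mdp_gamma_ge0 mdp)) normfV normr_nat.
  rewrite ler_wpM2r ?invr_ge0 ?ler0n // -mulrA -[leRHS]mulr1 ler_wpM2l //.
  rewrite -[leRHS]mul1r ler_pM ?(mdp_gamma_ge0 mdp) //.
  by case/andP: (mdp_gamma mdp) => _ /ltW.
have H0 : 0 <= H by rewrite ltW // (horizon_gt0 mdp).
move/(ler_wpM2r H0)/(ler_wpM2l (ler0n R 4)); rewrite !mulrA => /le_trans; apply.
by rewrite mulrAC ler_pdivrMr // mul1r.
Qed.

Lemma acc_noise_sum (om : Omega X A K M) n x a :
  acc_noise om n x a = \sum_(k < n) alpha ^+ (n.-1 - k) * noise_at om k x a.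
Proof.
elim: n => [|n IH]; first by rewrite big_ord0.
rewrite big_ord_recr /= subnn mul1r addrC IH big_distrr; congr (_ + _).
apply: eq_bigr => k _ /=; rewrite mulrA -exprS; congr (_ ^+ _ * _).
by case: n k {IH} => [[]//|n] k /=; rewrite subSn // -ltnS.
Qed.

Lemma acc_var_sum (om : Omega X A K M) n x a :
  acc_var om n x a = \sum_(k < n) (alpha ^+ (n.-1 - k)) ^+ 2 * noise_var_at om k x a.
Proof.
elim: n => [|n IH]; first by rewrite big_ord0.
rewrite big_ord_recr /= subnn expr0 expr1n mul1r addrC IH big_distrr; congr (_ + _).
apply: eq_bigr => k _ /=; rewrite mulrA -exprMn -exprS; congr ((_ ^+ _) ^+ _ * _).
by case: n k {IH} => [[]//|n] k /=; rewrite subSn // -ltnS.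
Qed.

(* [None] tests [acc_noise] with its own scale; [Some b] tests [noise] at two scales. *)
Definition deviation (lam : option bool -> R) (j : bool * option bool * 'I_K * X * A)
    (om : Omega X A K M) : R :=
  let: (sgn, kind, k, x, a) := j in
  let dev := if kind is Some _ then noise_at om k x a else acc_noise om k.+1 x a in
  let var := if kind is Some _ then noise_var_at om k x a else acc_var om k.+1 x a in
  lam kind * ((-1) ^+ sgn * dev) - 2 * lam kind ^+ 2 / M%:R * var.

Lemma expect_expR_deviation_le1 lam j :
  (forall kind, 0 <= lam kind) -> (forall kind, 4 * lam kind * H <= M%:R) ->
  expect law (fun om => expR (deviation lam j om)) <= 1.
Proof.
case: j => [[[[sgn kind] k] x] a] lam0 lamM.
(* Both kinds of deviation are signed weighted sums of all [K] noises: a point mass at [k], or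
   powers of [alpha] cut off after [k]. *)
pose c (i : nat) : R := (-1) ^+ sgn * (if kind is Some _ then (i == k)%:R
  else if (i <= k)%N then alpha ^+ (k - i) else 0).
have a01 n : 0 <= alpha ^+ n <= 1.
  rewrite exprn_ge0 ?(alpha_ge0 mdp) //= exprn_ile1 ?(alpha_ge0 mdp) //.
  by rewrite gerBl sqr_ge0.
have c1 i : `|c i| <= 1.
  rewrite /c normrM normrX normrN1 expr1n mul1r; case: (kind) => [_|].
    by case: (i == k); rewrite ?normr1 ?normr0.
  by case: ifP => _; rewrite ?normr0 // ger0_norm; case/andP: (a01 (k - i)%N).
have c2 i : c i ^+ 2 = (if kind is Some _ then (i == k)%:R
    else if (i <= k)%N then (alpha ^+ (k - i)) ^+ 2 else 0).
  rewrite /c exprMn sqrr_sign mul1r; case: (kind) => [_|].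
    by case: (i == k); rewrite ?expr1n ?expr0n.
  by case: ifP => _; rewrite ?expr0n.
have pick (d : nat -> R) (F : nat -> R) :
    \sum_(i < K) (if kind is Some _ then (val i == k)%:R else if (i <= k)%N then d i else 0) * F i =
    if kind is Some _ then F k else \sum_(i < k.+1) d i * F i.
  case: (kind) => [_|].
    rewrite (bigD1 k) //= eqxx mul1r big1 ?addr0 // => i /negbTE ik.
    by rewrite -(inj_eq val_inj) /= in ik; rewrite ik mul0r.
  rewrite (big_ord_widen K (fun i => d i * F i) (ltn_ord k)) [RHS]big_mkcond /=.
  by apply: eq_bigr => i _; rewrite ltnS; case: ifP => // _; rewrite mul0r.
have -> : (fun om => expR (deviation lam (sgn, kind, k, x, a) om)) =
    (fun om => expR (lam kind * (\sum_(i < K) c i * noise_at om i x a)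
     - 2 * lam kind ^+ 2 / M%:R * (\sum_(i < K) c i ^+ 2 * noise_var_at om i x a))).
  apply/funext => om; congr expR; rewrite /deviation; congr (_ - _); congr (_ * _).
    under eq_bigr => i _ do rewrite /c -mulrA.
    rewrite -big_distrr /= (pick (fun i => alpha ^+ (k - i)) (fun i => noise_at om i x a)).
    by case: (kind) => //; rewrite -(acc_noise_sum om k.+1).
  under eq_bigr => i _ do rewrite c2.
  rewrite (pick (fun i => (alpha ^+ (k - i)) ^+ 2) (fun i => noise_var_at om i x a)).
  by case: (kind) => //; rewrite -(acc_var_sum om k.+1).
exact: expect_expR_noise_le1.
Qed.

End Concentration.

(** * High-probability error bound for the last policy *)

Section PAC.
Variables (R : realType) (X A : finType) (a0 : A) (gamma : R).
Variables (r : X -> A -> R) (P : X -> A -> X -> R).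
Hypothesis mdp : is_mdp gamma r P.
Variables (K M : nat).
Hypothesis M_gt0 : (0 < M)%N.

Local Notation H := ((1 - gamma)^-1).
Local Notation alpha := (1 - (1 - gamma) ^+ 2).
Local Notation beta := (1 - (1 - gamma) ^+ 2 / 2).

(** Divide the exponent by [lam = m * eta / D]: the variance term becomes [2 * eta * W / D], and
    [L / lam <= eta * B]. *)
Lemma deviation_le (m eta D B N W L : R) :
  0 < m -> 0 < eta -> 0 < D -> L * D <= m * eta ^+ 2 * B ->
  m * eta / D * N - 2 * (m * eta / D) ^+ 2 / m * W < L ->
  N <= eta * (2 * W / D + B).
Proof.
move=> m0 eta0 D0 LD hN; set lam := m * eta / D in hN.
have lam0 : 0 < lam by rewrite divr_gt0 // mulr_gt0.
rewrite -(ler_pM2l lam0).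
have -> : lam * (eta * (2 * W / D + B)) = 2 * lam ^+ 2 / m * W + m * eta ^+ 2 * B / D.
  by rewrite /lam; field; rewrite !gt_eqF.
have : L <= m * eta ^+ 2 * B / D by rewrite ler_pdivlMr.
by lra.
Qed.

Lemma supnorm_mdvi_prob (sel : (X -> A -> R) -> X -> A) (eta L : R) :
  greedy_selector sel -> 0 < eta -> 256 * eta * H <= 1 -> L * H <= M%:R * eta ^+ 2 ->
  1 - (6 * K * #|X| * #|A|)%:R * expR (- L) <=
  Pr P (fun om : Omega X A K M =>
    let sK := (mdvi a0 alpha gamma r M (samp_of om) K).1.1 in
    let piK := @detpol R X A (sel sK) in
    supnorm (fun x => vstar gamma r P x - vpi gamma r P piK x)
      <= 14 * H * beta ^+ K + 122 * eta).
Proof.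
move=> sel_greedy eta0 etaH LH.
have H1 := horizon_ge1 mdp; have H0 := horizon_gt0 mdp.
have M0 : 0 < M%:R :> R by rewrite ltr0n.
pose g : R := Num.sqrt H.
have g0 : 0 < g by rewrite sqrtr_gt0.
have gg : g ^+ 2 = H by rewrite sqr_sqrtr // ltW.
have g1 : 1 <= g by rewrite -(@expr_ge1 _ 2) ?gg // ltW.
(* Since [D = H * B] at all three scales, the single condition [L * H <= M * eta^2] handles every
   deviation. *)
pose D (kind : option bool) :=
  match kind with None => H ^+ 2 | Some true => g * H | Some false => H end.
pose B (kind : option bool) :=
  match kind with None => H | Some true => g | Some false => 1 end.
have DE kind : D kind = H * B kind.
  by case: kind => [[]|] /=; rewrite ?mulr1 // mulrC.
have B1 kind : 1 <= B kind by case: kind => [[]|] /=.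
have D0 kind : 0 < D kind by rewrite DE mulr_gt0 // (lt_le_trans ltr01).
pose lam kind := M%:R * eta / D kind.
have lam_ge0 kind : 0 <= lam kind by rewrite divr_ge0 ?mulr_ge0 // ltW.
have lam_le kind : 4 * lam kind * H <= M%:R.
  have -> : 4 * lam kind * H = M%:R * (4 * eta * H) / D kind by rewrite /lam; ring.
  rewrite ler_pdivrMr // ler_pM2l //; apply: le_trans (_ : 1 <= _).
    have : 0 <= eta * H by rewrite mulr_ge0 // ltW.
    by move: H etaH => h ? ?; lra.
  by rewrite DE -[leLHS]mulr1 ler_pM.
have [V V_opt] := bellman_optimal_exists a0 mdp.
(* Two signs and three kinds account for the factor 6. *)
have -> : (6 * K * #|X| * #|A|)%N = #|{: bool * option bool * 'I_K * X * A}|.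
  by rewrite !card_prod card_option card_bool card_ord.
apply: (@union_bound R _ X (fun i : 'I_K * 'I_M * X * A => P i.1.2 i.2) _ _
  (deviation a0 gamma r P lam)) => [i|j|om dev_lt].
- exact: (mdp_dist mdp).
- exact: expect_expR_deviation_le1.
have dev_le kind k x a : (k < K)%N ->
    `|if kind is Some _ then noise a0 gamma r P M (samp_of om) k x a
      else acc_noise a0 gamma r P M (samp_of om) k.+1 x a| <=
    eta * (2 * (if kind is Some _ then noise_var a0 gamma r P M (samp_of om) k x a
      else acc_var a0 gamma r P M (samp_of om) k.+1 x a) / D kind + B kind).
  move=> kK.
  have LD : L * D kind <= M%:R * eta ^+ 2 * B kind.
    by rewrite DE mulrA ler_wpM2r // (le_trans ler01).
  have := dev_lt (false, kind, Ordinal kK, x, a).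
  have := dev_lt (true, kind, Ordinal kK, x, a).
  rewrite /deviation /= expr0 expr1 mul1r mulN1r.
  by rewrite ler_norml lerNl => /(deviation_le M0 eta0 (D0 _) LD) ->
    /(deviation_le M0 eta0 (D0 _) LD) ->.
have sel_max y a : score a0 gamma r M (samp_of om) K y a <=
    score a0 gamma r M (samp_of om) K y (sel (score a0 gamma r M (samp_of om) K) y).
  exact: sel_greedy.
apply: bigmax_le => [|x _].
  have bK := betaX_ge0 mdp K.
  by rewrite addr_ge0 // mulr_ge0 // ?mulr_ge0 // ltW.
have piP := @detpol_policy R X A (sel (score a0 gamma r M (samp_of om) K)).
rewrite ger0_norm ?subr_ge0; last exact: (vpi_le_vstar a0 mdp piP).
apply: le_trans (_ : V x - vpi gamma r P (detpol R (sel (score a0 gamma r M (samp_of om) K))) x <= _).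
  by rewrite lerD2r (vstar_le_super a0 mdp (proj1 V_opt)).
apply: (mdvi_suboptimality mdp M_gt0 V_opt g0 gg (ltW eta0) etaH _ _ _ _ sel_max)
  => [k y a kK|k y a kK|k y a].
- exact: (dev_le (Some true)).
- exact: (dev_le (Some false)).
(* Index [k] of a [None] deviation tests time [k + 1]; at time 0 the accumulated noise vanishes. *)
case: k => [_|k kK]; last exact: (dev_le None).
by rewrite /= normr0 mulr0 mul0r add0r mulr_ge0 // ltW.
Qed.

End PAC.

(** * Constants and sample size *)

Section Numerics.
Variable R : realType.

Lemma absz_ceil_itv (x : R) : 0 <= x -> x <= `|Num.ceil x|%N%:R <= x + 1.
Proof.
move=> x0; have c0 : 0 <= Num.ceil x by rewrite ceil_ge0; lra.
rewrite natr_absz ger0_norm //; have /andP[] := ceil_itv x.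
by rewrite rmorphB /= => ? ->; lra.
Qed.

Lemma subr1X_le_expR (t : R) k : t <= 1 -> (1 - t) ^+ k <= expR (- (k%:R * t)).
Proof.
move=> t1; rewrite -mulrN expRM_natl; apply: lerXn2r; rewrite ?nnegrE ?expR_ge0 ?subr_ge0 //.
exact: expR_ge1Dx.
Qed.

Lemma ler_ln_pos (x y : R) : 0 < x -> x <= y -> ln x <= ln y.
Proof. by move=> x0 xy; rewrite ler_ln ?posrE // (lt_le_trans x0). Qed.

Lemma accuracy_le (H b eps : R) : 0 < H -> b <= eps / (28 * H) ->
  0 < eps -> 14 * H * b + 122 * (eps / 256) <= eps.
Proof.
move=> H0 hb e0; have := ler_wpM2l (ltW (mulr_gt0 (ltr0n R 14) H0)) hb.
have -> : 14%:R * H * (eps / (28 * H)) = eps / 2 by field; rewrite gt_eqF.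
by lra.
Qed.

Lemma failure_le (z delta : R) : 0 < z -> 0 < delta ->
  6 * z * expR (- ln (16 * z / delta)) <= delta.
Proof.
move=> z0 d0; rewrite expRN lnK ?posrE ?divr_gt0 ?mulr_gt0 // invf_div mulrA.
rewrite ler_pdivrMr ?mulr_gt0 //.
by have := mulr_gt0 z0 d0; lra.
Qed.

(** With [c = 1 - gamma], the rate [c^2 / 2] of [beta] turns [5 H^2 l] into [5 l / 2 >= l]. *)
Lemma decay_le (H K l c : R) : c * H = 1 -> 5 * H ^+ 2 * l + 2 <= K -> 0 <= l ->
  l <= K * (c ^+ 2 / 2).
Proof.
move=> cH KE l0; have c2 : 0 <= c ^+ 2 / 2 by rewrite divr_ge0 ?sqr_ge0.
apply: le_trans (ler_wpM2r c2 KE).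
have -> : (5 * H ^+ 2 * l + 2) * (c ^+ 2 / 2) = (c * H) ^+ 2 * (5 / 2 * l) + c ^+ 2 by field.
by rewrite cH expr1n mul1r; have := sqr_ge0 c; lra.
Qed.

(** [K] and [M] are each bounded by one factor [Lam], whence the square. The logarithm in [M]
    contains [K], hence [ln Lam], which is at most [Lam]. *)
Lemma sample_complexity (c4 C1 C3 H n m eps delta K M : R) :
  C1 = 5 * ln 28 + 8 -> C3 = ln (16 * C1) + 4 ->
  1 <= c4 -> 1 <= H -> 1 <= n -> 1 <= m -> 0 < eps -> eps * H <= 1 -> 0 < delta < 1 ->
  1 <= K -> K <= 5 * H ^+ 2 * ln (28 * H / eps) + 3 ->
  0 <= M -> M <= c4 * H / eps ^+ 2 * ln (16 * K * n * m / delta) + 1 ->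
  K * M * n * m <= C1 * (c4 * C3 + 1) * H ^+ 3 * n * m / eps ^+ 2 *
    (1 + ln (H * n * m / (eps * delta))) ^+ 2.
Proof.
move=> C1E C3E c41 H1 n1 m1 e0 eH /andP[d0 d1] K1 KE M0 ME.
have H0 : 0 < H by lra.
have n0 : 0 < n by lra.
have m0 : 0 < m by lra.
have l28 : 0 <= ln (28 : R) by rewrite ln_ge0 ?ler1n.
have C18 : 8 <= C1 by lra.
have C10 : 0 < C1 by lra.
have l16 : 0 <= ln (16 * C1) by rewrite ln_ge0 //; lra.
have e1 : eps <= 1 by nra.
set Q := H * n * m / (eps * delta); set Lam := 1 + ln Q.
have nm1 : 1 <= n * m by nra.
have QE : Q = H / eps * (n * m / delta) by rewrite /Q; field; rewrite !gt_eqF.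
have HHe : H <= H / eps by rewrite ler_pdivlMr // ler_piMr // ltW.
have nmd1 : 1 <= n * m / delta by rewrite ler_pdivlMr // mul1r; lra.
have QH : H / eps <= Q by rewrite QE ler_peMr // ltW // divr_gt0.
have QH1 : H <= Q by exact: le_trans QH.
have Qnm : n * m / delta <= Q by rewrite QE ler_peMl //; lra.
have Lam1 : 1 <= Lam by rewrite lerDl ln_ge0 // (le_trans H1).
have KC : K <= C1 * H ^+ 2 * Lam.
  apply: le_trans KE _.
  have -> : ln (28 * H / eps) = ln 28 + ln (H / eps).
    by rewrite -mulrA lnM ?posrE ?divr_gt0.
  have := ler_ln_pos (divr_gt0 H0 e0) QH; rewrite -/Q => lnQ.
  have h2 : 1 <= H ^+ 2 by rewrite exprn_ege1.
  have hL : 1 <= H ^+ 2 * Lam by nra.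
  have : ln 28 * H ^+ 2 <= ln 28 * H ^+ 2 * Lam by rewrite ler_peMr // mulr_ge0 //; lra.
  have : H ^+ 2 * ln (H / eps) <= H ^+ 2 * Lam.
    by rewrite ler_wpM2l ?sqr_ge0 // /Lam; lra.
  by rewrite C1E; lra.
have lnK : ln (16 * K * n * m / delta) <= C3 * Lam.
  have hL0 : 0 < Lam by lra.
  apply: (@le_trans _ _ (ln ((16 * C1) * (H * H) * Lam * (n * m / delta)))).
    apply: ler_ln_pos; first by rewrite divr_gt0 ?mulr_gt0 //; lra.
    rewrite !mulrA ler_wpM2r ?invr_ge0 ?(ltW d0) // ler_wpM2r ?(ltW m0) // ler_wpM2r ?(ltW n0) //.
    by move: KC; rewrite expr2; lra.
  have -> : ln (16 * C1 * (H * H) * Lam * (n * m / delta)) =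
      ln (16 * C1) + (ln H + ln H) + ln Lam + ln (n * m / delta).
    rewrite [LHS]lnM ?posrE ?divr_gt0 ?mulr_gt0 //; congr (_ + _).
    rewrite [LHS]lnM ?posrE ?mulr_gt0 //; congr (_ + _).
    by rewrite [LHS]lnM ?posrE ?mulr_gt0 // (lnM (x := H)) ?posrE.
  (* The 4 in [C3] counts two copies of [ln H], one [ln Lam] and one [ln (n * m / delta)]. *)
  have := ler_ln_pos H0 QH1; have := ln_sublinear hL0.
  have : ln (n * m / delta) <= ln Q by apply: ler_ln_pos; rewrite ?divr_gt0 ?mulr_gt0.
  have : ln (16 * C1) <= ln (16 * C1) * Lam by rewrite ler_peMr.
  by rewrite C3E /Lam; lra.
have he1 : 1 <= H / eps ^+ 2.
  rewrite ler_pdivlMr ?exprn_gt0 // mul1r.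
  by apply: le_trans H1; rewrite exprn_ile1 // ltW.
have MC : M <= (c4 * C3 + 1) * (H / eps ^+ 2) * Lam.
  apply: le_trans ME _.
  have hc : 0 <= c4 * H / eps ^+ 2 by rewrite divr_ge0 ?mulr_ge0 ?sqr_ge0 //; lra.
  have := ler_wpM2l hc lnK.
  have : 1 <= H / eps ^+ 2 * Lam by nra.
  by move: (eps ^+ 2)^-1 => ie; lra.
have -> : C1 * (c4 * C3 + 1) * H ^+ 3 * n * m / eps ^+ 2 * Lam ^+ 2 =
   (C1 * H ^+ 2 * Lam) * ((c4 * C3 + 1) * (H / eps ^+ 2) * Lam) * n * m by ring.
by rewrite ler_wpM2r ?ler_wpM2r ?ler_pM // ?ltW //; lra.
Qed.

End Numerics.

Theorem theorem2 (R : realType) :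
  exists c3 c4 : R, 1 <= c3 /\ 1 <= c4 /\
  exists (C : R) (p : nat), 0 < C /\
  forall (X A : finType) (a0 : A) (gamma : R) (r : X -> A -> R)
         (P : X -> A -> X -> R) (delta eps : R),
    is_mdp gamma r P ->
    0 < delta < 1 ->
    let H := (1 - gamma)^-1 in
    0 < eps <= H^-1 ->
    let alpha : R := 1 - (1 - gamma) ^+ 2 in
    let K : nat :=
      `|Num.ceil (5 / (1 - alpha) * ln (c3 * H / eps) + 2)|%N in
    let M : nat :=
      `|Num.ceil (c4 * H / eps ^+ 2 *
                  ln (16 * K%:R * #|X|%:R * #|A|%:R / delta))|%N in
    (* with probability at least 1 - delta, ||v* - v^{pi_K}||_oo <= eps,
       for any deterministic greedy tie-breaking rule *)
    (forall sel : (X -> A -> R) -> X -> A,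
       greedy_selector sel ->
       1 - delta <=
       Pr P (fun om : Omega X A K M =>
         let sK := (mdvi a0 alpha gamma r M (samp_of om) K).1.1 in
         let piK := @detpol R X A (sel sK) in
         supnorm (fun x => vstar gamma r P x - vpi gamma r P piK x) <= eps))
    /\
    (* sample complexity K M |X||A| = O~(H^3 |X||A| / eps^2) *)
    ((K * M * #|X| * #|A|)%:R
       <= C * H ^+ 3 * #|X|%:R * #|A|%:R / eps ^+ 2 *
          (1 + ln (H * #|X|%:R * #|A|%:R / (eps * delta))) ^+ p).
Proof.
pose C1 : R := 5 * ln 28 + 8; pose C3 : R := ln (16 * C1) + 4.
have l28 : 0 <= ln (28 : R) by rewrite ln_ge0 ?ler1n.
have C18 : 8 <= C1 by rewrite /C1; lra.
have C30 : 4 <= C3 by rewrite lerDr ln_ge0 //; lra.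
(* [28 = 2 * 14] makes the transient [14 H beta^K] at most [eps / 2]; [256^2] comes from
   [eta = eps / 256], for which [122 eta < eps / 2]. *)
exists 28, (256 ^+ 2); split; first lra; split; first by rewrite exprn_ege1 // ler1n.
exists (C1 * (256 ^+ 2 * C3 + 1)), 2; split; first by rewrite mulr_gt0; lra.
move=> X A a0 gamma r P delta eps mdp d01 H /andP[e0 eH] alpha K M.
have /andP[d0 d1] := d01.
have H1 : 1 <= H := horizon_ge1 mdp; have H0 : 0 < H := horizon_gt0 mdp.
have HE : (1 - gamma) * H = 1 := horizonE mdp.
have epsH : eps * H <= 1 by rewrite -ler_pdivlMr // mul1r.
have alphaE : 5 / (1 - alpha) = 5 * H ^+ 2.
  by rewrite /alpha opprB addrCA subrr addr0 /H exprVn.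
have He1 : 1 <= H / eps by rewrite ler_pdivlMr // mul1r; nra.
have lnHe : 0 <= ln (28 * H / eps) by rewrite ln_ge0 // -mulrA; lra.
have /andP[K_ge K_le] : 5 * H ^+ 2 * ln (28 * H / eps) + 2 <= K%:R
    <= 5 * H ^+ 2 * ln (28 * H / eps) + 2 + 1.
  rewrite /K alphaE; apply: absz_ceil_itv.
  by rewrite addr_ge0 // mulr_ge0 // mulr_ge0 // sqr_ge0.
have K2 : 2 <= K%:R :> R.
  by apply: le_trans K_ge; rewrite lerDr mulr_ge0 // mulr_ge0 // sqr_ge0.
have A1 : 1 <= #|A|%:R :> R by rewrite ler1n; apply/card_gt0P; exists a0.
have [X0|X1] := posnP #|X|.
  split; last first.
    by rewrite X0 muln0 mul0n !(mulr0, mul0r).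
  move=> sel _; rewrite /Pr (eq_bigl xpredT) => [|om]; last first.
    by apply: bigmax_le => [|x _]; [exact: ltW | have := card0_eq X0 x].
  have [_ ->] := @product_law_dist R ('I_K * 'I_M * X * A)%type X (fun i => P i.1.2 i.2)
    (fun i => mdp_dist mdp i.1.2 i.2).
  by rewrite gerBl ltW.
have n1 : 1 <= #|X|%:R :> R by rewrite ler1n.
set L := ln (16 * K%:R * #|X|%:R * #|A|%:R / delta) in M *.
have arg1 : 16 <= 16 * K%:R * #|X|%:R * #|A|%:R / delta.
  rewrite ler_pdivlMr // -!mulrA ler_pM2l // (le_trans (ltW d1)) //.
  by rewrite mulr_ege1 ?mulr_ege1 //; lra.
have L0 : 0 < L by rewrite ln_gt0 //; lra.
have c0 : 0 < 256 ^+ 2 * H / eps ^+ 2 by rewrite divr_gt0 ?mulr_gt0 ?exprn_gt0.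
have /andP[M_ge M_le] : 256 ^+ 2 * H / eps ^+ 2 * L <= M%:R <= 256 ^+ 2 * H / eps ^+ 2 * L + 1.
  by rewrite /M; apply: absz_ceil_itv; rewrite mulr_ge0 // ltW.
have M_gt0 : (0 < M)%N by rewrite -(ltr0n R) (lt_le_trans _ M_ge) // mulr_gt0.
split; last first.
  rewrite !natrM -/C1 -/C3.
  apply: sample_complexity => //; by [lra | rewrite ?ler0n].
move=> sel sel_greedy.
have eta0 : 0 < eps / 256 by rewrite divr_gt0.
have LH : L * H <= M%:R * (eps / 256) ^+ 2.
  have := ler_wpM2r (sqr_ge0 (eps / 256)) M_ge; apply: le_trans.
  rewrite le_eqVlt; apply/orP; left; apply/eqP; field; rewrite gt_eqF //.
(* This is where the restriction [eps <= 1 / H] enters the error analysis. *)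
have etaH : 256 * (eps / 256) * H <= 1 by have -> : 256 * (eps / 256) = eps by field.
have prob := supnorm_mdvi_prob a0 mdp K M_gt0 sel_greedy eta0 etaH LH.
have t1 : (1 - gamma) ^+ 2 / 2 <= 1.
  have g0 := mdp_gamma_ge0 mdp; have /andP[_ g1] := mdp_gamma mdp.
  apply: le_trans (_ : (1 - gamma) ^+ 2 <= 1).
    by rewrite ler_piMr ?sqr_ge0 // invf_le1 // ler1n.
  by rewrite exprn_ile1 // ?subr_ge0 ?(ltW g1) // gerBl.
have betaK : (1 - (1 - gamma) ^+ 2 / 2) ^+ K <= eps / (28 * H).
  apply: le_trans (subr1X_le_expR K t1) _.
  have pos : 0 < 28 * H / eps by rewrite divr_gt0 ?mulr_gt0.
  have -> : eps / (28 * H) = expR (- ln (28 * H / eps)) by rewrite expRN lnK ?posrE // (invf_div _ eps).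
  by rewrite ler_expR lerN2; exact: decay_le HE K_ge lnHe.
have final := accuracy_le H0 betaK e0.
apply: le_trans (le_trans prob _).
  rewrite lerD2l lerN2 !natrM /L -!(mulrA _ K%:R) -!(mulrA _ (K%:R * _)).
  apply: failure_le => //.
  by rewrite !mulr_gt0 // (lt_le_trans ltr01) // (le_trans _ K2) // ler1n.
(* Enlarging the event increases its probability, as the weights are nonnegative. *)
rewrite /Pr [leLHS]big_mkcond [leRHS]big_mkcond /=; apply: ler_sum => om _.
have w0 : 0 <= weight P om by apply: prodr_ge0 => i _; case: mdp.
by case: ifP => [h|_]; [rewrite (le_trans h final) | case: ifP].
Qed.
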